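(* Let $\mathcal K$, $(\mathsf Z_k,\mathcal A_k,\Psi_k,\Phi_k)_{k\in\mathcal K}$, $(\mathsf X,\mathcal B,\Pi)$ be as in the context, with $\mathcal K$ finite, and let $P$ be a Markov transition kernel on $(\mathsf X,\mathcal B)$ with $\Pi P=\Pi$. Assume: (H1) There is a positive integer $t$ such that for every $k\in\mathcal K$ there is a Markov transition kernel $P_k:\mathsf Z_k\times\mathcal A_k\to[0,1]$ with (i) $\Phi_kP_k=\Phi_k$; (ii) $\|P_k^t\|_{\Phi_k}<1$, where $P_k^t$ is viewed as an operator on $L_0^2(\Phi_k)$; (iii) there is a constant $c_k>0$ such that $P((k,z),\{k\}\times A)\ge c_kP_k(z,A)$ for all $z\in\mathsf Z_k$, $A\in\mathcal A_k$. (H2) For some positive integer $s$, every entry of the matrix $\Gamma_P^s$ is positive. Then $\|P^t\|_{\Pi}<1$ (operator norm on $L_0^2(\Pi)$), and $P$ is $L^2(\Pi)$ geometrically convergent.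
   Context: Let $\mathcal K$ be a finite set. For each $k\in\mathcal K$ let $(\mathsf Z_k,\mathcal A_k)$ be a nonempty measurable space and $\Psi_k$ a nonzero finite measure on it; write $\Phi_k=\Psi_k/\Psi_k(\mathsf Z_k)$. Let $\mathsf X=\bigcup_{k\in\mathcal K}\{k\}\times\mathsf Z_k$, let $\mathcal B$ be the $\sigma$-algebra generated by the sets $\{k\}\times A$ with $k\in\mathcal K$, $A\in\mathcal A_k$, and let $\Pi$ be the probability measure on $(\mathsf X,\mathcal B)$ with $\Pi(\{k\}\times A)=\Psi_k(A)/\sum_{k'\in\mathcal K}\Psi_{k'}(\mathsf Z_{k'})$. For a probability space $(\mathsf Y,\mathcal F,\omega)$: $L^2(\omega)$ is the Hilbert space of square-integrable real functions (mod a.e. equality) with $\langle f,g\rangle_\omega=\int fg\,d\omega$, $\|f\|_\omega=\langle f,f\rangle_\omega^{1/2}$; $L_0^2(\omega)=\{f\in L^2(\omega):\int f\,d\omega=0\}$. A Markov transition kernel (Mtk) $T$ with $\omega T=\omega$ acts on $L_0^2(\omega)$ by $Tf(y)=\int T(y,dy')f(y')$, and $\|T\|_\omega=\sup_{f\in L_0^2(\omega)\setminus\{0\}}\|Tf\|_\omega/\|f\|_\omega$. $L_*^2(\omega)$ is the set of probability measures $\mu$ with $d\mu/d\omega\in L^2(\omega)$, and for such $\mu,\nu$, $\|\mu-\nu\|_\omega=\|d\mu/d\omega-d\nu/d\omega\|_\omega$. $T$ is $L^2(\omega)$ geometrically convergent if there are $\rho<1$ and $C:L_*^2(\omega)\to[0,\infty)$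 with $\|\mu T^t-\omega\|_\omega\le C(\mu)\rho^t$ for all $\mu\in L_*^2(\omega)$ and $t\ge0$. For $k,k'\in\mathcal K$, set $\gamma_{k,k'}=1$ if $\int_{\mathsf Z_k}\Psi_k(dz)P((k,z),\{k'\}\times\mathsf Z_{k'})>0$ and $\gamma_{k,k'}=0$ otherwise. Fixing an ordering $k_{(1)},\dots,k_{(|\mathcal K|)}$ of $\mathcal K$, $\Gamma_P$ is the $|\mathcal K|\times|\mathcal K|$ matrix with $(i,j)$ entry $\gamma_{k_{(i)},k_{(j)}}$. *)

(* Defs.v *)
From HB Require Import structures.
From mathcomp Require Import all_boot all_order all_algebra.
From mathcomp Require Import all_classical all_reals all_analysis.
Set Implicit Arguments. Unset Strict Implicit. Unset Printing Implicit Defensive.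
Import Order.TTheory GRing.Theory Num.Theory.
Local Open Scope classical_set_scope.
Local Open Scope ring_scope.

Section L2defs.
Context {d : measure_display} {Y : measurableType d} {R : realType}.

Definition kop (T : R.-pker Y ~> Y) (f : Y -> R) : Y -> R :=
  fun y => fine (\int[T y]_z (f z)%:E)%E.

Definition kpow (T : R.-pker Y ~> Y) (n : nat) : (Y -> R) -> (Y -> R) :=
  iter n (kop T).

Definition L2norm (om : {measure set Y -> \bar R}) (f : Y -> R) : \bar R :=
  ('N[om]_2%:E[EFin \o f])%E.

Definition L2_0 (om : {measure set Y -> \bar R}) (f : Y -> R) : Prop :=
  [/\ measurable_fun setT f, (L2norm om f < +oo)%E & (\int[om]_y (f y)%:E = 0)%E].

Definition opnorm (om : {measure set Y -> \bar R}) (A : (Y -> R) -> (Y -> R)) : \bar R :=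
  ereal_sup [set (L2norm om (A f) / L2norm om f)%E
            | f in [set f | L2_0 om f /\ L2norm om f != 0%E]].

Definition kinvariant (om : {measure set Y -> \bar R}) (T : R.-pker Y ~> Y) : Prop :=
  forall B : set Y, measurable B -> (\int[om]_y T y B = om B)%E.

Definition mker (mu : {measure set Y -> \bar R}) (T : R.-pker Y ~> Y) (n : nat)
  : set Y -> \bar R :=
  fun B => (\int[mu]_y ((kpow T n (\1_B)) y)%:E)%E.

Definition is_density (om : {measure set Y -> \bar R}) (nu : set Y -> \bar R)
  (g : Y -> R) : Prop :=
  measurable_fun setT g /\
  forall B : set Y, measurable B -> nu B = (\int[om]_(y in B) (g y)%:E)%E.

Definition L2star (om : {measure set Y -> \bar R}) (mu : probability Y R) : Prop :=
  exists h : Y -> R, [/\ measurable_fun setT h, (L2norm om h < +oo)%E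
                        & is_density om mu h].

Definition L2_geom_conv (om : probability Y R) (T : R.-pker Y ~> Y) : Prop :=
  exists rho : R, rho < 1 /\
  exists C : probability Y R -> R, (forall mu, L2star om mu -> 0 <= C mu) /\
  forall mu : probability Y R, L2star om mu -> forall n : nat,
    exists g : Y -> R, is_density om (mker mu T n) g /\
      (L2norm om (fun y => (g y - 1)%R) <= (C mu * rho ^+ n)%:E)%E.

End L2defs.

(** the underlying set (k0 only witnesses that K is nonempty, needed for the
    pointed structure required by MathComp-Analysis; it is a phantom argument) *)
Definition Xt (K : finType) (k0 : K) (dZ : K -> measure_display)
  (Z : forall k, measurableType (dZ k)) : Type := {k : K & Z k}.

Section XtPt.
Variables (K : finType) (k0 : K) (dZ : K -> measure_display)
          (Z : forall k, measurableType (dZ k)).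
Definition Xt_point : @Xt K k0 dZ Z := @existT K (fun k => Z k) k0 (@point (Z k0)).
HB.instance Definition _ := Choice.copy (@Xt K k0 dZ Z) {k : K & Z k}.
HB.instance Definition _ := isPointed.Build (@Xt K k0 dZ Z) Xt_point.
End XtPt.

Section Mixture2.
Context (K : finType) (k0 : K) (dZ : K -> measure_display)
        (Z : forall k, measurableType (dZ k)).

Definition mixinj (k : K) (z : Z k) : @Xt K k0 dZ Z := existT _ k z.

Definition rect (k : K) (A : set (Z k)) : set (@Xt K k0 dZ Z) := (@mixinj k) @` A.

Definition Xgen : set (set (@Xt K k0 dZ Z)) :=
  [set B | exists k (A : set (Z k)), measurable A /\ B = @rect k A].

Definition Xsp := g_sigma_algebraType Xgen.
End Mixture2.
Arguments mixinj {K} k0 {dZ Z k} z.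
Arguments rect {K} k0 {dZ Z k} A.
Arguments Xgen {K} k0 {dZ} Z.
Arguments Xsp {K} k0 {dZ} Z.

Definition GammaP (R : realType) (K : finType) (k0 : K) (dZ : K -> measure_display)
  (Z : forall k, measurableType (dZ k))
  (Psi : forall k, {finite_measure set (Z k) -> \bar R})
  (P : R.-pker (Xsp k0 Z) ~> (Xsp k0 Z)) : 'M[int]_#|K| :=
  \matrix_(i, j)
    (if (0 < \int[Psi (enum_val i)]_z
           P (mixinj k0 z) (rect k0 (@setT (Z (enum_val j)))))%E
     then 1 else 0).

(* Main.v *)
(** For a Markov kernel T with invariant law w,
      |f|^2 - |T f|^2 = int w(dx) Var_{T(x,-)}(f),
    and Var_mu(f), being the infimum over a of int (f - a)^2 dmu, is monotone in
    mu. Since P^t dominates c_k^t P_k^t on block k, the defect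
    D = |f|^2 - |P^t f|^2 bounds the variance of f inside each block, by the
    spectral gap of P_k^t. Since D also bounds |f|^2 - |P f|^2, and P stays in
    block k with probability at least c_k, D bounds (m_k - m_l)^2 for the block
    means m whenever P moves from k to l with positive probability; positivity of
    a power of Gamma_P chains these bounds. Hence |f|^2 <= C D for f of mean 0,
    which is the spectral gap. Geometric convergence follows by duality: the
    density g of mu P^n satisfies
      int (g - 1) f dPi = int (dmu/dPi - 1) P^n f dPi. *)
Require Import Defs.
From HB Require Import structures.
From mathcomp Require Import all_boot all_order all_algebra.
From mathcomp Require Import all_classical all_reals all_analysis.
From mathcomp Require Import measurable_realfun.
From mathcomp Require Import zify ring lra.
Import Order.TTheory GRing.Theory Num.Theory.
Local Open Scope classical_set_scope.
Local Open Scope ring_scope.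

Set Implicit Arguments. Unset Strict Implicit. Unset Printing Implicit Defensive.

(** * Second moments and variances *)

Section second_moment.
Context {d : measure_display} {Y : measurableType d} {R : realType}.
Implicit Types (mu : {measure set Y -> \bar R}) (f g : Y -> R).

(** Jumps between blocks see values of f, not its block means. So f is compared with the
    block-constant function m; the error, the integral of (m - f)^2 under P(x,-), averages by
    invariance to the within-block variance, which D already bounds. Powers of P occur in two forms:
    [kpow] iterates an operator whose divergent integrals default to 0, while [kiter] is the n-step
    kernel, under whose laws variances make sense. For an invariant law and a square-integrable f
    they agree almost everywhere. Variances take extended real values, so that inequalities between
    them hold at every point and only identities involve null sets. In the duality the natural
    choice f = g - 1 would be circular, since square integrability of g is part of the claim;
    truncations with a uniform bound replace it. *)

Definition sqint mu f : \bar R := (\int[mu]_x ((f x) ^+ 2)%:E)%E.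

Definition mean mu f : R := fine (\int[mu]_x (f x)%:E)%E.

Lemma measurable_sqr f : measurable_fun setT f ->
  measurable_fun setT (fun x => ((f x) ^+ 2)%:E : \bar R).
Proof. by move=> mf; apply/measurable_EFinP; exact: measurable_funX. Qed.

Lemma measurable_subc f (a : R) : measurable_fun setT f ->
  measurable_fun setT (fun x => f x - a).
Proof. by move=> mf; apply: measurable_funB. Qed.

Lemma sqint_ge0 mu f : (0 <= sqint mu f)%E.
Proof. by apply: integral_ge0 => x _; rewrite lee_fin sqr_ge0. Qed.

Lemma sqint_fin mu f : (sqint mu f < +oo)%E -> sqint mu f \is a fin_num.
Proof. by move=> h; rewrite ge0_fin_numE// sqint_ge0. Qed.

Lemma integrable_sqr mu f : measurable_fun setT f -> (sqint mu f < +oo)%E ->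
  mu.-integrable setT (fun x => ((f x) ^+ 2)%:E : \bar R).
Proof.
move=> mf h; apply/integrableP; split; first exact: measurable_sqr.
rewrite (le_lt_trans _ h)//; under eq_integral do rewrite gee0_abs ?lee_fin ?sqr_ge0//.
exact: lexx.
Qed.

Lemma integrable_cst mu (a : R) : (mu setT < +oo)%E ->
  mu.-integrable setT (fun=> a%:E).
Proof.
move=> h; apply/integrableP; split => //.
by rewrite integral_cst// lte_mul_pinfty// ?lee_fin// normr_ge0.
Qed.

Lemma integrable_prod mu f g : measurable_fun setT f -> measurable_fun setT g ->
  (sqint mu f < +oo)%E -> (sqint mu g < +oo)%E ->
  mu.-integrable setT (fun x => (f x * g x)%:E).
Proof.
move=> mf mg hf hg.
have hs := integrableD measurableT (integrable_sqr mf hf) (integrable_sqr mg hg).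
apply: (le_integrable measurableT _ _ hs).
  by apply/measurable_EFinP; exact: measurable_funM.
move=> x _ /=; rewrite lee_fin normrM [leRHS]ger0_norm ?addr_ge0 ?sqr_ge0//.
rewrite -(real_normK (num_real (f x))) -(real_normK (num_real (g x))).
move: (`|f x|) (`|g x|) (normr_ge0 (f x)) (normr_ge0 (g x)) => a b a0 b0.
nra.
Qed.

Lemma integrable_of_sqr mu f : mu setT = 1%E -> measurable_fun setT f ->
  (sqint mu f < +oo)%E -> mu.-integrable setT (EFin \o f).
Proof.
move=> mu1 mf hf.
have h1 : (sqint mu (fun=> 1%R) < +oo)%E.
  rewrite /sqint; under eq_integral do rewrite expr1n.
  by rewrite integral_cst// mu1 mule1 ltry.
have := integrable_prod mf (measurable_cst _) hf h1.
by apply: eq_integrable => // x _ /=; rewrite mulr1.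
Qed.

Lemma sqint_sub mu f (a : R) : mu setT = 1%E -> measurable_fun setT f ->
  (sqint mu f < +oo)%E ->
  sqint mu (fun x => f x - a) =
  (fine (sqint mu f) - 2 * a * mean mu f + a ^+ 2)%:E.
Proof.
move=> mu1 mf hf.
have i1 := integrable_of_sqr mu1 mf hf.
have i2 := integrable_sqr mf hf.
have i3 := @integrable_cst mu (a ^+ 2); rewrite mu1 in i3; have {}i3 := i3 (ltry _).
have i4 := integrableZl measurableT (- (2 * a)) i1.
rewrite /sqint; transitivity (\int[mu]_x (((f x) ^+ 2)%:E +
    ((- (2 * a))%:E * (EFin \o f) x) + (a ^+ 2)%:E))%E.
  apply: eq_integral => x _ /=; rewrite -EFinM -!EFinD; congr EFin; ring.
rewrite integralD//; last exact: integrableD.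
rewrite integralD// integralZl// integral_cst// mu1 mule1.
rewrite -[X in (X + _ + _)%E]fineK ?sqint_fin//.
rewrite -[X in (_ + _ * X + _)%E]fineK ?integrable_fin_num//.
by rewrite -EFinM -!EFinD mulNr.
Qed.

(** Bias-variance decomposition: by [sqint_sub] both sides are the same quadratic polynomial in
    [a]. *)
Lemma sqint_sub_mean mu f (a : R) : mu setT = 1%E -> measurable_fun setT f ->
  (sqint mu f < +oo)%E ->
  sqint mu (fun x => f x - a) =
  (sqint mu (fun x => f x - mean mu f)%R + ((mean mu f - a) ^+ 2)%:E)%E.
Proof.
by move=> mu1 mf hf; rewrite !sqint_sub// -EFinD; congr EFin; ring.
Qed.

Lemma sqint_mean mu f : mu setT = 1%E -> measurable_fun setT f ->
  (sqint mu f < +oo)%E ->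
  sqint mu f = (sqint mu (fun x => f x - mean mu f)%R + ((mean mu f) ^+ 2)%:E)%E.
Proof.
move=> mu1 mf hf; rewrite -{2}(subr0 (mean mu f)) -sqint_sub_mean//.
by congr sqint; apply/funext => x; rewrite subr0.
Qed.

Lemma sqintD_le mu f g : measurable_fun setT f -> measurable_fun setT g ->
  (sqint mu (fun x => f x + g x)%R <= 2%:E * sqint mu f + 2%:E * sqint mu g)%E.
Proof.
move=> mf mg; rewrite /sqint -!ge0_integralZl_EFin//; try exact: measurable_sqr.
2,3: by move=> x _; rewrite lee_fin sqr_ge0.
rewrite -ge0_integralD//; try by apply: measurable_funeM; exact: measurable_sqr.
2,3: by move=> x _; rewrite -EFinM lee_fin mulr_ge0 ?sqr_ge0.
apply: ge0_le_integral => //.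
- by move=> x _; rewrite lee_fin sqr_ge0.
- by apply: measurable_sqr; exact: measurable_funD.
- by apply: emeasurable_funD; apply: measurable_funeM; exact: measurable_sqr.
move=> x _; rewrite -!EFinM -EFinD lee_fin.
have := sqr_ge0 (f x - g x); nra.
Qed.

Lemma sqint_sub_lty mu f (a : R) : (mu setT < +oo)%E -> measurable_fun setT f ->
  (sqint mu f < +oo)%E -> (sqint mu (fun x => f x - a)%R < +oo)%E.
Proof.
move=> muT mf hf; rewrite (le_lt_trans (sqintD_le mu mf (measurable_cst (- a))))//.
rewrite lte_add_pinfty ?lte_mul_pinfty ?lee_fin ?ler0n//.
by rewrite /sqint /= integral_cst// lte_mul_pinfty// lee_fin sqr_ge0.
Qed.

(** Square integrability of f is not assumed: if the right side is finite, shifting back by [a]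
    provides it. This makes [kvar_le] valid at every point. *)
Lemma sqint_sub_mean_le mu f (a : R) : mu setT = 1%E -> measurable_fun setT f ->
  (sqint mu (fun x => f x - mean mu f)%R <= sqint mu (fun x => f x - a)%R)%E.
Proof.
move=> mu1 mf; have [h|] := ltP (sqint mu (fun x => f x - a)) +oo%E; last first.
  by rewrite leye_eq => /eqP ->; rewrite leey.
have hf : (sqint mu f < +oo)%E.
  have := @sqint_sub_lty mu _ (- a) _ (measurable_subc a mf) h.
  rewrite mu1 ltry => /(_ isT); congr (_ < _)%E; congr sqint.
  by apply/funext => x; rewrite opprK subrK.
by rewrite [leRHS]sqint_sub_mean// leeDl// lee_fin sqr_ge0.
Qed.

End second_moment.

(** * Composition and iteration of Markov kernels *)

Section kernel_composition.
Context d1 d2 d3 (X : measurableType d1) (Y : measurableType d2)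
  (Z : measurableType d3) (R : realType).

(** [mkcomp] composes with a kernel that also sees the starting point; this one forgets it. *)
Definition ksnd (S : R.-pker Y ~> Z) : X * Y -> {measure set Z -> \bar R} :=
  fun p => S p.2.

Section ksnd_kernel.
Variable S : R.-pker Y ~> Z.

Let measurable_ksnd U : measurable U -> measurable_fun setT (ksnd S ^~ U).
Proof.
by move=> mU; exact: (measurableT_comp (measurable_kernel S U mU) measurable_snd).
Qed.

HB.instance Definition _ :=
  @isKernel.Build _ _ _ _ _ (ksnd S) measurable_ksnd.

Let ksnd_prob p : ksnd S p setT = 1%E.
Proof. exact: prob_kernel. Qed.

HB.instance Definition _ :=
  @Kernel_isProbability.Build _ _ _ _ _ (ksnd S) ksnd_prob.
End ksnd_kernel.

Definition kthen (T : R.-pker X ~> Y) (S : R.-pker Y ~> Z) :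
  X -> {measure set Z -> \bar R} := mkcomp T (ksnd S).

Section kthen_kernel.
Variables (T : R.-pker X ~> Y) (S : R.-pker Y ~> Z).

Let measurable_kthen U : measurable U -> measurable_fun setT (kthen T S ^~ U).
Proof. exact: measurable_fun_mkcomp_sfinite. Qed.

HB.instance Definition _ :=
  @isKernel.Build _ _ _ _ _ (kthen T S) measurable_kthen.

Let kthen_prob x : kthen T S x setT = 1%E.
Proof.
rewrite /kthen /mkcomp /= /kcomp /ksnd /=.
under eq_integral do rewrite prob_kernel.
by rewrite integral_cst// mul1e prob_kernel.
Qed.

HB.instance Definition _ :=
  @Kernel_isProbability.Build _ _ _ _ _ (kthen T S) kthen_prob.
End kthen_kernel.

Lemma kthenE (T : R.-pker X ~> Y) (S : R.-pker Y ~> Z) x U :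
  kthen T S x U = (\int[T x]_y S y U)%E.
Proof. by []. Qed.

Lemma integral_kthen (T : R.-pker X ~> Y) (S : R.-pker Y ~> Z) x
    (f : Z -> \bar R) :
  (forall z, 0 <= f z)%E -> measurable_fun setT f ->
  (\int[kthen T S x]_z f z = \int[T x]_y \int[S y]_z f z)%E.
Proof. exact: integral_kcomp. Qed.

End kernel_composition.

Section constant_kernel.
Context d1 d2 (X : measurableType d1) (Y : measurableType d2) (R : realType).

(** A law viewed as a kernel: facts about [om] followed by T become instances of facts about
    [kthen], evaluated at an arbitrary point. *)
Definition kcst (mu : probability Y R) (x : X) : {measure set Y -> \bar R} := mu.

Variable mu : probability Y R.

Let measurable_kcst U : measurable U -> measurable_fun setT (kcst mu ^~ U).
Proof. by move=> mU; exact: measurable_cst. Qed.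

HB.instance Definition _ :=
  @isKernel.Build _ _ X Y R (kcst mu) measurable_kcst.

Let kcst_prob x : kcst mu x setT = 1%E.
Proof. exact: probability_setT. Qed.

HB.instance Definition _ :=
  @Kernel_isProbability.Build _ _ X Y R (kcst mu) kcst_prob.
End constant_kernel.

Section identity_kernel.
Context d (Y : measurableType d) (R : realType).

Definition kid : R.-pker Y ~> Y := kdirac (@measurable_id _ Y setT).

(** The n-step kernel, whose laws carry the variances; [kpow] only acts on functions. *)
Fixpoint kiter (T : R.-pker Y ~> Y) (n : nat) : R.-pker Y ~> Y :=
  if n is n'.+1 then kthen T (kiter T n') else kid.

Lemma integral_kid y (f : Y -> \bar R) : measurable_fun setT f ->
  (\int[kid y]_z f z = f y)%E.
Proof. by move=> mf; rewrite integral_dirac// diracT mul1e. Qed.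

End identity_kernel.

Section invariance.
Context d (Y : measurableType d) (R : realType).
Implicit Types (om : probability Y R) (T S : R.-pker Y ~> Y).

Lemma integral_kinvariant om T (f : Y -> \bar R) : kinvariant om T ->
  (forall y, 0 <= f y)%E -> measurable_fun setT f ->
  (\int[om]_x \int[T x]_y f y = \int[om]_y f y)%E.
Proof.
move=> inv f0 mf.
rewrite -(@integral_kthen _ _ _ Y Y Y R (kcst om) T point f f0 mf).
by apply: eq_measure_integral => A mA _; rewrite kthenE inv.
Qed.

Lemma kinvariant_kthen om T S : kinvariant om T -> kinvariant om S ->
  kinvariant om (kthen T S).
Proof.
move=> iT iS B mB; under eq_integral do rewrite kthenE.
rewrite integral_kinvariant//; first exact: iS.
exact: measurable_kernel.
Qed.

Lemma kinvariant_kiter om T n : kinvariant om T -> kinvariant om (kiter T n).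
Proof.
move=> iT; elim: n => [|n ih] /=; last exact: kinvariant_kthen.
move=> B mB; rewrite /kid /=.
under eq_integral do rewrite diracE.
rewrite -[in RHS](setIT B) -integral_indic//.
Qed.

End invariance.

Section mean_kernel.
Context d1 d2 d3 (X : measurableType d1) (Y : measurableType d2)
  (Z : measurableType d3) (R : realType).

Lemma measurable_mean (S : R.-pker Y ~> Z) (f : Z -> R) :
  measurable_fun setT f -> measurable_fun setT (fun y => mean (S y) f).
Proof.
move=> mf; apply: (measurableT_comp (fine_measurable measurableT)).
under eq_fun do rewrite integralE.
apply: emeasurable_funB; apply: measurable_fun_integral_kernel => //.
- by move=> U mU; exact: measurable_kernel.
- exact/measurable_funepos/measurable_EFinP.
- by move=> U mU; exact: measurable_kernel.
- exact/measurable_funeneg/measurable_EFinP.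
Qed.

(** Tower property for signed f. Both parts of f have finite integral under [S y] only for almost
    every y, so [mean (S y) f] is the difference of these integrals almost everywhere. *)
Lemma integral_mean_kthen (T : R.-pker X ~> Y) (S : R.-pker Y ~> Z) x
    (f : Z -> R) : (kthen T S x).-integrable setT (EFin \o f) ->
  (\int[T x]_y (mean (S y) f)%:E = \int[kthen T S x]_z (f z)%:E)%E.
Proof.
move=> fi; have mf := measurable_int _ fi.
have mS (g : Z -> \bar R) : (forall z, 0 <= g z)%E -> measurable_fun setT g ->
    measurable_fun setT (fun y => \int[S y]_z g z)%E.
  by move=> g0 mg; apply: measurable_fun_integral_kernel => // U mU; exact: measurable_kernel.
have SI (g : Z -> \bar R) : (forall z, 0 <= g z)%E -> measurable_fun setT g ->
    (\int[kthen T S x]_z g z < +oo)%E ->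
    (T x).-integrable setT (fun y => \int[S y]_z g z)%E.
  move=> g0 mg gi; apply/integrableP; split; first exact: mS.
  rewrite integral_kthen// in gi.
  under eq_integral do rewrite gee0_abs ?integral_ge0//.
  exact: gi.
have ip := SI _ (funepos_ge0 (EFin \o f)) (measurable_funepos mf)
  (integral_funepos_lt_pinfty measurableT fi).
have im := SI _ (funeneg_ge0 (EFin \o f)) (measurable_funeneg mf)
  (integral_funeneg_lt_pinfty measurableT fi).
rewrite [RHS]integralE !integral_kthen//.
2,3: by [exact: measurable_funeneg | exact: measurable_funepos].
rewrite -integralB//; apply: ae_eq_integral => //.
- by apply/measurable_EFinP; apply: measurable_mean; exact/measurable_EFinP.
- by apply: emeasurable_funB; apply: measurable_int; eassumption.
have := integrable_ae measurableT ip; have := integrable_ae measurableT im.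
apply: filterS2 => y /(_ I) hm /(_ I) hp _.
by rewrite /mean integralE fineK// fin_numB hp hm.
Qed.

Lemma ae_integrable_kthen (T : R.-pker X ~> Y) (S : R.-pker Y ~> Z) x
    (f : Z -> R) : (kthen T S x).-integrable setT (EFin \o f) ->
  {ae T x, forall y, (S y).-integrable setT (EFin \o f)}.
Proof.
move=> /integrableP[mf fi].
have i : (T x).-integrable setT (fun y => \int[S y]_z `|(EFin \o f) z|)%E.
  apply/integrableP; split.
    apply: measurable_fun_integral_kernel => //.
      by move=> U mU; exact: measurable_kernel.
    exact: measurableT_comp.
  rewrite integral_kthen// in fi; last exact: measurableT_comp.
  by under eq_integral do rewrite gee0_abs ?integral_ge0//.
have := integrable_ae measurableT i; apply: filterS => y /(_ I) fin.
by apply/integrableP; split => //; rewrite -ge0_fin_numE// integral_ge0.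
Qed.

End mean_kernel.

(** * Kernels as operators, and the law of total variance *)

Section kernel_operator.
Context d (Y : measurableType d) (R : realType).
Implicit Types (om : probability Y R) (T S : R.-pker Y ~> Y) (f : Y -> R).

Lemma kopE T f y : kop T f y = mean (T y) f.
Proof. by []. Qed.

Lemma measurable_kop T f : measurable_fun setT f -> measurable_fun setT (kop T f).
Proof. exact: measurable_mean. Qed.

Lemma measurable_kpow T n f : measurable_fun setT f ->
  measurable_fun setT (kpow T n f).
Proof. by move=> mf; elim: n => // n; exact: measurable_kop. Qed.

(* [kop] takes the junk value 0 where the integral diverges, so iterating it
   agrees with the n-step kernel only at points where f is integrable. *)
Lemma kpow_kiter T n f y : (kiter T n y).-integrable setT (EFin \o f) ->
  kpow T n f y = kop (kiter T n) f y.
Proof.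
elim: n y => [|n ih] y fi.
  by rewrite kopE /mean integral_kid//; exact: measurable_int fi.
have mf : measurable_fun setT f by apply/measurable_EFinP; exact: measurable_int fi.
rewrite [RHS]/kop -(integral_mean_kthen fi).
congr fine; apply: ae_eq_integral => //.
- by apply/measurable_EFinP; exact: measurable_kpow.
- by apply/measurable_EFinP; exact: measurable_mean.
by have := ae_integrable_kthen fi; apply: filterS => z /ih h _; exact: congr1 h.
Qed.

Lemma integral_kthen_kcst om T y (g : Y -> \bar R) : kinvariant om T ->
  (\int[kthen (kcst om : R.-pker Y ~> Y) T y]_z g z = \int[om]_z g z)%E.
Proof.
by move=> inv; apply: eq_measure_integral => A mA _; rewrite kthenE inv.
Qed.

Lemma integrable_kthen_kcst om T y (g : Y -> \bar R) : kinvariant om T ->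
  om.-integrable setT g ->
  (kthen (kcst om : R.-pker Y ~> Y) T y).-integrable setT g.
Proof.
by move=> inv /integrableP gi; apply/integrableP; rewrite integral_kthen_kcst.
Qed.

Lemma integral_kop om T f : kinvariant om T -> om.-integrable setT (EFin \o f) ->
  (\int[om]_y (kop T f y)%:E = \int[om]_y (f y)%:E)%E.
Proof.
move=> inv fi; rewrite -[RHS](integral_kthen_kcst point _ inv).
by rewrite -(integral_mean_kthen (integrable_kthen_kcst point inv fi)).
Qed.

Lemma ae_integrable_kinvariant om T f : kinvariant om T ->
  om.-integrable setT (EFin \o f) ->
  {ae om, forall y, (T y).-integrable setT (EFin \o f)}.
Proof.
by move=> inv /(integrable_kthen_kcst point inv)/ae_integrable_kthen.
Qed.

(* Variance of f under T(y, -), as an extended real: it is nonnegative and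
   satisfies [kvar_le] everywhere, even where [kop] takes its junk value. *)
Definition kvar T f y : \bar R := sqint (T y) (fun z => f z - kop T f y).

Lemma kvar_ge0 T f y : (0 <= kvar T f y)%E.
Proof. exact: sqint_ge0. Qed.

Lemma measurable_sqint T f : measurable_fun setT f ->
  measurable_fun setT (fun y => sqint (T y) f).
Proof.
move=> mf; apply: measurable_fun_integral_kernel.
- by move=> U mU; exact: measurable_kernel.
- by move=> z; rewrite lee_fin sqr_ge0.
- exact: measurable_sqr.
Qed.

Lemma measurable_kvar T f : measurable_fun setT f -> measurable_fun setT (kvar T f).
Proof.
move=> mf.
(* The integrand depends on y through its centre [kop T f y] too, hence joint measurability. *)
have := measurable_fun_integral_sfinite_kernel
  (fun p : Y * Y => ((f p.2 - kop T f p.1) ^+ 2)%:E) T.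
apply; first by move=> p; rewrite lee_fin sqr_ge0.
apply: measurable_sqr; apply: measurable_funB; apply: measurableT_comp => //.
exact: measurable_kop.
Qed.

(** At almost every y the second moment of f under [T y] is finite and splits into squared mean plus
    variance; by invariance these second moments integrate to that of f. *)
Lemma sqint_kvar om T f : kinvariant om T -> measurable_fun setT f ->
  (sqint om f < +oo)%E ->
  sqint om f = (sqint om (kop T f) + \int[om]_y kvar T f y)%E.
Proof.
move=> inv mf hf; have mk := measurable_kop T mf.
have msq := @measurable_sqint T f mf.
have e : sqint om f = (\int[om]_y sqint (T y) f)%E.
  rewrite /sqint integral_kinvariant//; last exact: measurable_sqr.
  by move=> y; rewrite lee_fin sqr_ge0.
rewrite e /sqint -ge0_integralD//; last 4 first.
- by move=> y _; rewrite lee_fin sqr_ge0.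
- exact: measurable_sqr.
- by move=> y _; exact: kvar_ge0.
- exact: measurable_kvar.
apply: ge0_ae_eq_integral => //.
- by apply: emeasurable_funD; [exact: measurable_sqr|exact: measurable_kvar].
- by move=> y _; exact: sqint_ge0.
- by move=> y _; rewrite adde_ge0 ?kvar_ge0// lee_fin sqr_ge0.
have i : om.-integrable setT (fun y => sqint (T y) f).
  apply/integrableP; split => //.
  by under eq_integral do rewrite gee0_abs ?sqint_ge0//; rewrite -e.
have := integrable_ae measurableT i; apply: filterS => y /(_ I) fin _.
rewrite -/(sqint (T y) f) addeC sqint_mean ?prob_kernel// -ge0_fin_numE//.
exact: sqint_ge0.
Qed.

Lemma sqint_kop_le om T f : kinvariant om T -> measurable_fun setT f ->
  (sqint om f < +oo)%E -> (sqint om (kop T f) <= sqint om f)%E.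
Proof.
move=> inv mf hf; rewrite [leRHS](sqint_kvar inv)// leeDl//.
by apply: integral_ge0 => y _; exact: kvar_ge0.
Qed.

Lemma sqint_kpow_le om T n f : kinvariant om T -> measurable_fun setT f ->
  (sqint om f < +oo)%E -> (sqint om (kpow T n f) <= sqint om f)%E.
Proof.
move=> inv mf hf; elim: n => [|n ih] //.
rewrite (le_trans (sqint_kop_le inv (measurable_kpow T n mf) _))//.
exact: le_lt_trans ih hf.
Qed.

(** Invariance of the n-step kernel makes f integrable under almost all its laws, and there
    [kpow_kiter] applies. *)
Lemma sqint_kpow om T n f : kinvariant om T -> measurable_fun setT f ->
  (sqint om f < +oo)%E -> sqint om (kpow T n f) = sqint om (kop (kiter T n) f).
Proof.
move=> inv mf hf; apply: ge0_ae_eq_integral => //.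
- exact/measurable_sqr/measurable_kpow.
- exact/measurable_sqr/measurable_kop.
- by move=> y _; rewrite lee_fin sqr_ge0.
- by move=> y _; rewrite lee_fin sqr_ge0.
have := ae_integrable_kinvariant (kinvariant_kiter n inv)
  (integrable_of_sqr (probability_setT _) mf hf).
by apply: filterS => y /kpow_kiter h _; congr (_ ^+ 2)%:E.
Qed.

End kernel_operator.

(** * The disjoint union of the blocks *)

Section mixture_space.
Context (R : realType) (K : finType) (k0 : K) (dZ : K -> measure_display)
  (Z : forall k, measurableType (dZ k)).
Local Notation X := (Xsp k0 Z).

(** [mixinj] with codomain [Xsp], the type that carries the sigma-algebra. *)
Definition inj k (z : Z k) : X := mixinj k0 z.

Lemma inj_inj k : injective (@inj k).
Proof. by move=> z z' e; exact: (@eq_from_Tagged K Z k z z' e). Qed.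

Lemma measurable_rect k (A : set (Z k)) : measurable A ->
  measurable (rect k0 A : set X).
Proof. by move=> mA; apply: sub_sigma_algebra; exists k, A. Qed.

Lemma inj_preimage_rect k (A : set (Z k)) : @inj k @^-1` (rect k0 A) = A.
Proof.
apply/seteqP; split=> [z [w Aw /inj_inj <-]//|z Az].
by exists z.
Qed.

Lemma inj_preimage_rect0 k l (A : set (Z l)) : k != l ->
  @inj k @^-1` (rect k0 A) = set0.
Proof.
move=> /eqP kl; apply/seteqP; split=> // z [w Aw] /(congr1 (@tag _ _)) /= e.
exact: kl.
Qed.

Lemma rect_inj_preimage k (B : set X) :
  rect k0 (@inj k @^-1` B) = B `&` rect k0 (@setT (Z k)).
Proof.
apply/seteqP; split=> [x [z Bz <-]|x [Bx [z _ e]]].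
  by split=> //; exists z.
by exists z => //; rewrite /preimage/= /inj e.
Qed.

Lemma measurable_inj k : measurable_fun setT (@inj k).
Proof.
apply: (@measurability _ _ (Z k) X setT (@inj k) (Xgen k0 Z) erefl).
move=> _ [_ [l [A [mA ->]]] <-]; rewrite setTI.
have [e|kl] := eqVneq k l; last by rewrite inj_preimage_rect0.
by case: _ / e A mA => A mA; rewrite inj_preimage_rect.
Qed.

HB.instance Definition _ k := @isMeasurableFun.Build _ _ _ _ (@inj k) (@measurable_inj k).

Lemma measurable_comp_inj {d'} {T : measurableType d'} k (h : X -> T) :
  measurable_fun setT h -> measurable_fun setT (h \o @inj k).
Proof. by move=> mh; exact: measurableT_comp mh (@measurable_inj k). Qed.

(** Every measurable subset of block k is [rect] of its preimage, so on that block [mu] is the image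
    of [c nu] under [inj]. *)
Lemma ge0_integral_rect k (mu : {measure set X -> \bar R})
    (nu : {measure set (Z k) -> \bar R}) (c : {nonneg R}) (h : X -> \bar R) :
  (forall A, measurable A -> mu (rect k0 A) = c%:num%:E * nu A)%E ->
  (forall x, 0 <= h x)%E -> measurable_fun setT h ->
  (\int[mu]_(x in rect k0 (@setT (Z k))) h x = c%:num%:E * \int[nu]_z h (inj z))%E.
Proof.
move=> munu h0 mh.
rewrite (eq_measure_integral (pushforward (mscale c nu) (@inj k))); last first.
  move=> A mA /setIidPl AD; rewrite -{1}AD -rect_inj_preimage munu//.
  rewrite -[X in measurable X]setTI; exact: measurable_inj.
rewrite ge0_integral_pushforward//; last first.
- exact: measurable_funTS.
- exact: measurable_rect.
rewrite inj_preimage_rect ge0_integral_mscale//; first exact: measurable_comp_inj.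
by move=> z _; exact: h0.
Qed.

(** The image of [c nu] lies below [mu], since discarding what lies outside block k only lowers
    [mu]. With [mu] a law of P, this turns the minorization of P by the block kernel into a bound on
    integrals. *)
Lemma ge0_le_integral_rect k (mu : {measure set X -> \bar R})
    (nu : {measure set (Z k) -> \bar R}) (c : {nonneg R}) (h : X -> \bar R) :
  (forall A, measurable A -> c%:num%:E * nu A <= mu (rect k0 A))%E ->
  (forall x, 0 <= h x)%E -> measurable_fun setT h ->
  (c%:num%:E * \int[nu]_z h (inj z) <= \int[mu]_x h x)%E.
Proof.
move=> munu h0 mh; rewrite -ge0_integral_mscale//; last exact: measurable_comp_inj.
rewrite -(@ge0_integral_pushforward _ _ _ _ _ (@inj k) _ (mscale c nu) setT h)//.
apply: ge0_le_measure_integral => //= B mB.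
have mi : measurable (@inj k @^-1` B) by rewrite -[X in measurable X]setTI; exact: measurable_inj.
apply: (le_trans (munu _ mi)); rewrite rect_inj_preimage.
by apply: le_measure; rewrite ?inE//; apply: measurableI => //; exact: measurable_rect.
Qed.

Lemma trivIset_rect (D : set K) :
  trivIset D (fun k => rect k0 (@setT (Z k)) : set X).
Proof.
move=> k l _ _ [x [[z _ <-] [w _]]] /(congr1 (@tag _ _)) /= ->.
by [].
Qed.

Lemma rect_bigsetU :
  \big[setU/set0]_(k : K) (rect k0 (@setT (Z k)) : set X) = setT.
Proof.
rewrite -bigcup_seq; apply/seteqP; split=> // -[k z] _.
by exists k; [rewrite /= mem_index_enum|exists z].
Qed.

Lemma measurable_fun_inj {d'} {T : measurableType d'} (h : X -> T) :
  (forall k, measurable_fun setT (h \o @inj k)) -> measurable_fun setT h.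
Proof.
move=> mh _ B mB; rewrite setTI -(setIT (h @^-1` B)) -rect_bigsetU.
rewrite big_distrr; apply: bigsetU_measurable => k _.
rewrite /= -rect_inj_preimage; apply: measurable_rect.
by have := mh k measurableT B mB; rewrite setTI.
Qed.

Section mixture_measure.
Variables (p : K -> {nonneg R}) (Phi : forall k, {measure set (Z k) -> \bar R})
  (Pi : {measure set X -> \bar R}).
Hypothesis Pi_rect : forall k (A : set (Z k)), measurable A ->
  Pi (rect k0 A) = ((p k)%:num%:E * Phi k A)%E.

Lemma integral_mix (h : X -> \bar R) :
  (forall x, 0 <= h x)%E -> measurable_fun setT h ->
  (\int[Pi]_x h x = \sum_k (p k)%:num%:E * \int[Phi k]_z h (inj z))%E.
Proof.
move=> h0 mh; rewrite -rect_bigsetU ge0_integral_bigsetU//=.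
- apply: eq_bigr => k _; apply: ge0_integral_rect => // A; exact: Pi_rect.
- by move=> k; exact: measurable_rect.
- exact: index_enum_uniq.
- exact: trivIset_rect.
- by rewrite rect_bigsetU.
Qed.
End mixture_measure.

End mixture_space.

(** * Operator norms and variance lower bounds *)

Section L2_norm.
Context d (Y : measurableType d) (R : realType).
Implicit Types (om : {measure set Y -> \bar R}) (f : Y -> R).

Lemma L2norm_sqint om f : L2norm om f = (sqint om f `^ 2^-1)%E.
Proof.
rewrite /L2norm unlock /sqint; congr (_ `^ _)%E.
by apply: eq_integral => x _ /=; rewrite powR_mulrn// real_normK ?num_real.
Qed.

Lemma L2norm_fin om f : (sqint om f < +oo)%E ->
  L2norm om f = (Num.sqrt (fine (sqint om f)))%:E.
Proof.
move=> /sqint_fin h; rewrite L2norm_sqint -{1}(fineK h) poweR_EFin powR12_sqrt//.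
by rewrite fine_ge0// sqint_ge0.
Qed.

Lemma L2norm_lty om f : (L2norm om f < +oo)%E <-> (sqint om f < +oo)%E.
Proof.
split=> [|h]; last by rewrite L2norm_fin// ltry.
rewrite L2norm_sqint; have := sqint_ge0 om f.
case: (sqint om f) => [r| |] // _; first by move=> _; exact: ltry.
by rewrite poweRyr// invr_eq0 pnatr_eq0.
Qed.

Lemma L2norm_eq0 om f : (sqint om f < +oo)%E -> (L2norm om f == 0%E) = (sqint om f == 0%E).
Proof.
move=> h; rewrite L2norm_fin// eqe sqrtr_eq0.
rewrite -[in RHS](fineK (sqint_fin h)) eqe.
by rewrite eq_le fine_ge0 ?sqint_ge0// andbT.
Qed.

(** Contractivity of A keeps the norms finite, so the quotients are real, and settles the functions
    of norm 0, which the supremum ignores. *)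
Lemma opnorm_lt1P om (A : (Y -> R) -> (Y -> R)) :
  (forall f, L2_0 om f -> (sqint om (A f) <= sqint om f)%E) ->
  (opnorm om A < 1)%E <->
  exists r : R, [/\ 0 <= r, r < 1 &
    forall f, L2_0 om f -> (sqint om (A f) <= r%:E * sqint om f)%E].
Proof.
move=> Acontr; split=> [|[r [r0 r1 Ar]]].
  set e := opnorm om A => e1.
  (* The supremum is -oo when no function of nonzero norm exists, so a nonnegative bound is chosen
     by cases. *)
  have [r [r0 r1 er]] : exists r : R, [/\ 0 <= r, r < 1 & (e <= r%:E)%E].
    case: (e) e1 => [r| |] //; last by exists 0; split => //; rewrite leNye.
    rewrite lte_fin => r1; exists (Num.max 0 r); split.
    - by rewrite le_max lexx.
    - by rewrite gt_max ltr01.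
    - by rewrite lee_fin le_max lexx orbT.
  exists (r ^+ 2); split; [exact: sqr_ge0|by rewrite expr_lt1|].
  move=> f f0; have [mf /L2norm_lty hf _] := f0.
  have Af := Acontr _ f0; have hAf := le_lt_trans Af hf.
  have [z|nz] := eqVneq (sqint om f) 0%E.
    by rewrite z mule0 -z.
  have : (L2norm om (A f) / L2norm om f <= r%:E)%E.
    apply: le_trans er; apply: ereal_sup_ubound; exists f => //; split => //.
    by rewrite L2norm_eq0.
  have b0 : 0 < fine (sqint om f).
    by rewrite fine_gt0// lt0e nz sqint_ge0 hf.
  rewrite !L2norm_fin// inver (gt_eqF (_ : 0 < Num.sqrt _)) ?sqrtr_gt0// -EFinM lee_fin.
  rewrite ler_pdivrMr ?sqrtr_gt0// => h.
  rewrite -(fineK (sqint_fin hf)) -(fineK (sqint_fin hAf)) -EFinM lee_fin.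
  have a0 : 0 <= fine (sqint om (A f)) by rewrite fine_ge0// sqint_ge0.
  rewrite -(sqr_sqrtr a0) -(sqr_sqrtr (ltW b0)) -exprMn ler_pXn2r//.
  - by rewrite nnegrE sqrtr_ge0.
  - by rewrite nnegrE mulr_ge0 ?sqrtr_ge0.
apply: (@le_lt_trans _ _ (Num.sqrt r)%:E); last first.
  by rewrite lte_fin -(sqrtr1 R) ltr_sqrt.
apply: ub_ereal_sup => _ [f [f0 nz] <-].
have [mf /L2norm_lty hf _] := f0.
have hAf := le_lt_trans (Acontr _ f0) hf.
rewrite L2norm_eq0// in nz.
have b0 : 0 < fine (sqint om f).
  by rewrite fine_gt0// lt0e nz sqint_ge0 hf.
rewrite !L2norm_fin// inver (gt_eqF (_ : 0 < Num.sqrt _)) ?sqrtr_gt0// -EFinM lee_fin.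
rewrite ler_pdivrMr ?sqrtr_gt0// -sqrtrM// ler_wsqrtr//.
have := Ar _ f0.
by rewrite -{1}(fineK (sqint_fin hf)) -{1}(fineK (sqint_fin hAf)) -EFinM lee_fin.
Qed.

End L2_norm.

(** * Operator norm below 1 as a lower bound on variances *)

Section variance_gap.
Context d (Y : measurableType d) (R : realType).
Implicit Types (om : probability Y R) (T : R.-pker Y ~> Y) (f : Y -> R).

Lemma probability_lty om : ((om : {measure set Y -> \bar R}) setT < +oo)%E.
Proof. by have e : om setT = 1%E := probability_setT om; rewrite [ltLHS]e ltry. Qed.

Lemma integral_subc om f (a : R) : om.-integrable setT (EFin \o f) ->
  (\int[om]_y (f y - a)%:E = \int[om]_y (f y)%:E - a%:E)%E.
Proof.
move=> fi; under eq_integral do rewrite EFinB.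
have ai : om.-integrable setT (EFin \o (fun=> a)).
  exact: (integrable_cst _ (probability_lty om)).
have e : om setT = 1%E := probability_setT om.
by rewrite (integralB_EFin measurableT fi ai) integral_cst// [X in (_ * X)%E]e mule1.
Qed.

Lemma L2_0_center om f : measurable_fun setT f -> (sqint om f < +oo)%E ->
  L2_0 om (fun y => f y - mean om f).
Proof.
move=> mf hf; have fi := integrable_of_sqr (probability_setT om) mf hf.
split; first exact: measurable_subc.
- by apply/L2norm_lty; apply: sqint_sub_lty => //; exact: probability_lty.
- by rewrite integral_subc// /mean fineK ?subee//; exact: integrable_fin_num.
Qed.

Lemma sqint_kpow_le_L2_0 om T n : kinvariant om T ->
  forall f, L2_0 om f -> (sqint om (kpow T n f) <= sqint om f)%E.
Proof. by move=> inv f [mf /L2norm_lty hf _]; exact: sqint_kpow_le. Qed.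

Lemma kvar_le T f y (a : R) : measurable_fun setT f ->
  (kvar T f y <= sqint (T y) (fun z => f z - a)%R)%E.
Proof. by move=> mf; apply: sqint_sub_mean_le => //; exact: prob_kernel. Qed.

(** The constant is [1 - r]: for the centred function the squared norm drops by a factor [r], and
    the variance identity says that the lost part is the integrated variance. *)
Lemma kvar_gap om T t : kinvariant om T -> (opnorm om (kpow T t) < 1)%E ->
  exists2 k : R, 0 < k & forall f, measurable_fun setT f -> (sqint om f < +oo)%E ->
  (k%:E * sqint om (fun y => f y - mean om f)%R <= \int[om]_y kvar (kiter T t) f y)%E.
Proof.
move=> inv /(opnorm_lt1P (sqint_kpow_le_L2_0 t inv))[r [r0 r1 gap]].
exists (1 - r); first by rewrite subr_gt0.
move=> f mf hf; have g0 := L2_0_center mf hf.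
have [mg /L2norm_lty hg _] := g0; set g := (fun y => _) in g0 mg hg *.
have := gap _ g0; rewrite sqint_kpow// => gapg.
have e := sqint_kvar (kinvariant_kiter t inv) mg hg.
have kle : (\int[om]_y kvar (kiter T t) g y <= \int[om]_y kvar (kiter T t) f y)%E.
  apply: ge0_le_integral => //.
  - by move=> y _; exact: kvar_ge0.
  - exact: measurable_kvar.
  - exact: measurable_kvar.
  (* Using [kvar_le] with this centre avoids the identity kop (f - c) = kop f - c, which can fail
     where f is not integrable. *)
  move=> y _; rewrite (le_trans (kvar_le _ _ (kop (kiter T t) f y - mean om f) mg))//.
  rewrite le_eqVlt; apply/orP; left; apply/eqP; congr sqint.
  by apply/funext => z; rewrite /g; ring.
apply: (le_trans _ kle).
move: e gapg; rewrite -(fineK (sqint_fin hg)).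
move: (fine (sqint om g)) (sqint om (kop _ g)) (\int[om]_y kvar _ g y)%E => a q K.
by case: q K => [q| |] [k| |] //; rewrite -!EFinM -EFinD => -[->]; rewrite !lee_fin; lra.
Qed.

End variance_gap.

(** * Minorization by a block kernel along several steps *)

Section block_domination.
Context (R : realType) (K : finType) (k0 : K) (dZ : K -> measure_display)
  (Z : forall k, measurableType (dZ k)).
Local Notation X := (Xsp k0 Z).
Variables (k : K) (c : {nonneg R}).

(** Keep only the paths whose first step stays in block k and apply induction from there; each step
    costs a factor [c]. *)
Lemma kiter_dominate (P : R.-pker X ~> X) (Q : R.-pker Z k ~> Z k) n :
  (forall z A, measurable A -> c%:num%:E * Q z A <= P (inj k0 z) (rect k0 A))%E ->
  forall z A, measurable A ->
    ((c%:num ^+ n)%:E * kiter Q n z A <= kiter P n (inj k0 z) (rect k0 A))%E.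
Proof.
move=> PQ; elim: n => [|n ih] z A mA.
  by rewrite mul1e /= !diracE -[in leLHS](inj_preimage_rect k0 A).
rewrite /= !kthenE exprS EFinM -muleA.
have mk : measurable_fun setT (fun y => kiter P n y (rect k0 A)).
  by apply: measurable_kernel; exact: measurable_rect.
apply: le_trans (ge0_le_integral_rect (PQ z) _ mk) => //.
apply: lee_wpmul2l; first by rewrite lee_fin.
rewrite -ge0_integralZl_EFin ?exprn_ge0//; last exact: measurable_kernel.
apply: ge0_le_integral => //.
- by apply: measurable_funeM; exact: measurable_kernel.
- exact: (measurable_comp_inj (k := k) mk).
- by move=> w _; exact: ih.
Qed.

Lemma kvar_dominate (P : R.-pker X ~> X) (Q : R.-pker Z k ~> Z k) (f : X -> R) z :
  (forall z A, measurable A -> c%:num%:E * Q z A <= P (inj k0 z) (rect k0 A))%E ->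
  measurable_fun setT f ->
  (c%:num%:E * kvar Q (f \o @inj K k0 dZ Z k) z <= kvar P f (inj k0 z))%E.
Proof.
move=> PQ mf; apply: le_trans; last first.
  apply: (ge0_le_integral_rect (PQ z)) => //; last first.
    exact/measurable_sqr/measurable_subc.
  by move=> x; rewrite lee_fin sqr_ge0.
apply: lee_wpmul2l; first by rewrite lee_fin.
by apply: kvar_le; exact: measurable_comp_inj.
Qed.

End block_domination.

Lemma ereal_le_divl (R : realType) (c : R) (x y : \bar R) : 0 < c ->
  (c%:E * x <= y)%E -> (x <= c^-1%:E * y)%E.
Proof.
move=> c0; have cV : (0 <= (c^-1)%:E)%E by rewrite lee_fin invr_ge0 ltW.
by move=> /(lee_wpmul2l cV); rewrite muleA -EFinM mulVf ?gt_eqF// mul1e.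
Qed.

Lemma sumr_ge_term (R : realType) (K : finType) (F : K -> R) k :
  (forall i, 0 <= F i) -> F k <= \sum_i F i.
Proof. by move=> F0; rewrite (bigD1 k)//= lerDl sumr_ge0. Qed.

Lemma sqrrD_le4 (R : realDomainType) (x y M N : R) :
  x ^+ 2 <= N -> y ^+ 2 <= M -> M <= N -> (x + y) ^+ 2 <= 4 * N.
Proof. by move=> hx hy MN; have := sqr_ge0 (x - y); nra. Qed.

Lemma pker_le1 d d' (X : measurableType d) (Y : measurableType d') (R : realType)
  (Q : R.-pker X ~> Y) x (A : set Y) : measurable A -> (Q x A <= 1)%E.
Proof.
move=> mA; apply: (@le_trans _ _ (Q x setT)); last by rewrite prob_kernel.
by apply: le_measure; rewrite ?inE.
Qed.

(** * Chaining bounds along a positive matrix power *)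

Section matrix_power_connects.
Context (R : realDomainType) (n : nat) (G : 'M[int]_n).
Hypothesis G_ge0 : forall i j, 0 <= G i j.

Lemma matrix_power_ge0 s i j : 0 <= (G ^+ s) i j.
Proof.
elim: s i j => [|s ih] i j; first by rewrite expr0 -idmxE mxE; case: eqP.
rewrite exprSr -mulmxE mxE; apply: sumr_ge0 => l _; exact: mulr_ge0.
Qed.

(** As entries are nonnegative, a positive entry of [G ^+ s.+1] contains a term with two positive
    factors: a path of length s followed by an edge. Appending the edge costs at most a factor 4,
    because (x + y)^2 <= 2 x^2 + 2 y^2. *)
Lemma matrix_power_dist (m : 'I_n -> R) (M : R) : 0 <= M ->
  (forall i j, 0 < G i j -> (m i - m j) ^+ 2 <= M) ->
  forall s i j, 0 < (G ^+ s) i j -> (m i - m j) ^+ 2 <= 4 ^+ s * M.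
Proof.
move=> M0 step; elim=> [|s ih] i j.
  rewrite expr0 -idmxE mxE; case: eqP => // -> _.
  by rewrite subrr expr0n mulr_ge0.
rewrite exprSr -mulmxE mxE => sum0.
have [l /andP[il lj]] : exists l, (0 < (G ^+ s) i l) && (0 < G l j).
  apply/existsP; apply: contraLR sum0 => /existsPn h; rewrite -leNgt.
  apply: sumr_le0 => l _; have := h l; rewrite negb_and -!leNgt => /orP[] h'.
    have -> : (G ^+ s) i l = 0 by apply/eqP; rewrite eq_le h' matrix_power_ge0.
    by rewrite mul0r.
  have -> : G l j = 0 by apply/eqP; rewrite eq_le h' G_ge0.
  by rewrite mulr0.
have := ih _ _ il; have := step _ _ lj.
have h1 : M <= 4 ^+ s * M by rewrite ler_peMl// exprn_ege1// ler1n.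
rewrite [4 ^+ s.+1]exprS -mulrA; move: (4 ^+ s * M) h1 => N h1.
move=> hj hi; rewrite -[m i](subrK (m l)) -addrA.
exact: sqrrD_le4 hi hj h1.
Qed.

End matrix_power_connects.

(** * Variance within and between blocks *)

Section block_estimates.
Context (R : realType) (K : finType) (k0 : K) (dZ : K -> measure_display)
  (Z : forall k, measurableType (dZ k)).
Local Notation X := (Xsp k0 Z).
Variables (p : K -> {nonneg R}) (Phi : forall k, probability (Z k) R)
  (Pi : probability X R).
Hypothesis p_gt0 : forall k, 0 < (p k)%:num.
Hypothesis Pi_rect : forall k (A : set (Z k)), measurable A ->
  Pi (rect k0 A) = ((p k)%:num%:E * Phi k A)%E.
Variables (P : R.-pker X ~> X).
Hypothesis P_inv : kinvariant Pi P.

Local Notation blk f k := (f \o @inj K k0 dZ Z k).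

Lemma integral_block_le k (h : X -> \bar R) :
  (forall x, 0 <= h x)%E -> measurable_fun setT h ->
  ((p k)%:num%:E * \int[Phi k]_z h (inj k0 z) <= \int[Pi]_x h x)%E.
Proof.
move=> h0 mh; rewrite (integral_mix Pi_rect h0 mh) (bigD1 k)//= leeDl//.
by apply: sume_ge0 => l _; rewrite mule_ge0// integral_ge0.
Qed.

Lemma sqint_block_lty k (f : X -> R) : measurable_fun setT f ->
  (sqint Pi f < +oo)%E -> (sqint (Phi k) (blk f k) < +oo)%E.
Proof.
move=> mf hf.
have f0 x : (0 <= (f x ^+ 2)%:E)%E by rewrite lee_fin sqr_ge0.
apply: (le_lt_trans (ereal_le_divl (p_gt0 k) (integral_block_le k f0 (measurable_sqr mf)))).
by rewrite lte_mul_pinfty// lee_fin invr_ge0.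
Qed.

Lemma block_variance t k :
  (exists Pk : R.-pker Z k ~> Z k,
     [/\ kinvariant (Phi k) Pk, (opnorm (Phi k) (kpow Pk t) < 1%:E)%E
       & exists c : R, 0 < c /\ forall z (A : set (Z k)), measurable A ->
             (c%:E * Pk z A <= P (mixinj k0 z) (rect k0 A))%E]) ->
  exists2 a : R, 0 <= a & forall f : X -> R, measurable_fun setT f ->
    (sqint Pi f < +oo)%E ->
    ((p k)%:num%:E * sqint (Phi k) (fun z => blk f k z - mean (Phi k) (blk f k))%R
      <= a%:E * \int[Pi]_x kvar (kiter P t) f x)%E.
Proof.
move=> [Pk [inv gap [c [c0 dom]]]].
have [q q0 hq] := kvar_gap inv gap.
(* [q] is the variance gap of the t-step block kernel, and [c ^+ t] the cost of comparing it with t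
   steps of P. *)
exists ((c ^+ t * q)^-1); first by rewrite invr_ge0 mulr_ge0 ?exprn_ge0 ?ltW.
move=> f mf hf; apply: ereal_le_divl; first by rewrite mulr_gt0 ?exprn_gt0.
have mk := measurable_kvar (kiter P t) mf.
apply: le_trans (integral_block_le k (kvar_ge0 _ _) mk).
rewrite muleCA; apply: lee_wpmul2l; first by rewrite lee_fin.
have mfk := measurable_comp_inj (k := k) mf.
rewrite EFinM -muleA.
apply: (@le_trans _ _
  ((c ^+ t)%:E * \int[Phi k]_z kvar (kiter Pk t) (blk f k) z)%E).
  apply: lee_wpmul2l; first by rewrite lee_fin exprn_ge0 ?ltW.
  by apply: hq => //; exact: sqint_block_lty.
rewrite -ge0_integralZl_EFin ?exprn_ge0 ?(ltW c0)//; last 2 first.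
- by move=> z _; exact: kvar_ge0.
- exact: measurable_kvar.
apply: ge0_le_integral => //.
- by move=> z _; rewrite mule_ge0 ?kvar_ge0// lee_fin exprn_ge0 ?ltW.
- by apply: measurable_funeM; exact: measurable_kvar.
- exact: (measurable_comp_inj (k := k) mk).
move=> z _; pose c' := NngNum (ltW c0).
apply: (@kvar_dominate _ _ _ _ _ k (NngNum (exprn_ge0 t (ltW c0)))) => //.
exact: (@kiter_dominate _ _ _ _ _ k c').
Qed.

Lemma measurable_block_cst (m : K -> R) :
  measurable_fun setT (fun x : X => m (tag x)).
Proof. by apply: measurable_fun_inj => k; exact: (measurable_cst (m k)). Qed.

Lemma indic_rect k (x : X) :
  \1_(rect k0 (@setT (Z k)) : set X) x = (tag x == k)%:R :> R.
Proof.
rewrite indicE; congr (_%:R); congr nat_of_bool; apply/idP/eqP.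
  by rewrite inE => -[z _ <-].
by case: x => l z /= e; rewrite inE; case: _ / e z => z; exists z.
Qed.

(** Here [a] and [b] are the distances of two block values from a common centre, and [r] and [q] the
    masses of the blocks. Both masses are at least [c * q], and (a - b)^2 <= 2 (a^2 + b^2). *)
Lemma weighted_jump_le (a b c d q r : R) : 0 <= c -> c <= 1 -> c <= r -> 0 <= q -> q <= 1 ->
  d = a - b -> 2 * (c * d ^+ 2 / 4 * q) <= a ^+ 2 * r + b ^+ 2 * q.
Proof.
move=> c0 c1 cr q0 q1 ->.
have h1 : a ^+ 2 * (c * q) <= a ^+ 2 * r.
  by rewrite ler_wpM2l ?sqr_ge0// (le_trans _ cr)// ler_piMr.
have h2 : b ^+ 2 * (c * q) <= b ^+ 2 * q.
  by rewrite ler_wpM2l ?sqr_ge0// ler_piMl.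
apply: le_trans (lerD h1 h2).
have -> : 2 * (c * (a - b) ^+ 2 / 4 * q) = (a - b) ^+ 2 / 2 * (c * q) by field.
rewrite -mulrDl ler_wpM2r ?mulr_ge0// ler_pdivrMr//.
by have := sqr_ge0 (a + b); nra.
Qed.

(* From block k the chain stays in k with probability at least c and reaches l
   with probability q, so the variance of a function equal to [m] on the blocks
   is at least of order c q (m k - m l)^2; the last term accounts for f - m. *)
Lemma kernel_jump (Q : R.-pker X ~> X) (f : X -> R) (m : K -> R) k l x (c : R) :
  measurable_fun setT f -> 0 <= c -> c <= 1 ->
  (c%:E <= Q x (rect k0 (@setT (Z k))))%E ->
  ((c * ((m k - m l) ^+ 2) / 4)%:E * Q x (rect k0 (@setT (Z l))) <=
   kvar Q f x + sqint (Q x) (fun y => m (tag y) - f y)%R)%E.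
Proof.
move=> mf c0 c1 cQ.
have [->|kl] := eqVneq k l.
  rewrite subrr expr0n mulr0 mul0r mul0e.
  by rewrite adde_ge0 ?kvar_ge0 ?sqint_ge0.
have mR j : measurable (rect k0 (@setT (Z j)) : set X) by exact: measurable_rect.
have Q1 j : (Q x (rect k0 (@setT (Z j))) <= 1)%E by exact: pker_le1.
have Qfin j : Q x (rect k0 (@setT (Z j))) \is a fin_num.
  by rewrite ge0_fin_numE// (le_lt_trans (Q1 j))// ltry.
pose a := kop Q f x.
have mm := measurable_block_cst m.
(* Split m - a as (f - a) + (m - f); the factor 2 is cancelled by doubling the goal. *)
have up : (sqint (Q x) (fun y => m (tag y) - a)%R <=
    2%:E * (kvar Q f x + sqint (Q x) (fun y => m (tag y) - f y)%R))%E.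
  rewrite ge0_muleDr ?kvar_ge0 ?sqint_ge0//.
  have := @sqintD_le _ _ R (Q x) (fun y => f y - a) (fun y => m (tag y) - f y)
    (measurable_subc a mf) (measurable_funB mm mf).
  apply: le_trans; rewrite le_eqVlt; apply/orP; left; apply/eqP; congr sqint.
  by apply/funext => y; ring.
rewrite -(@lee_pmul2l _ 2%:E)//.
apply: (le_trans _ up).
(* Only the mass on the two distinct blocks k and l is kept. *)
apply: (@le_trans _ _ (((m k - a) ^+ 2)%:E * Q x (rect k0 (@setT (Z k))) +
    ((m l - a) ^+ 2)%:E * Q x (rect k0 (@setT (Z l))))%E).
  have := Q1 l; have := measure_ge0 (Q x) (rect k0 (@setT (Z l))); move: cQ.
  rewrite -(fineK (Qfin k)) -(fineK (Qfin l)) -!EFinM -EFinD !lee_fin.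
  move=> ck q0 q1; apply: weighted_jump_le => //; ring.
have ind j : Q x (rect k0 (@setT (Z j))) =
    (\int[Q x]_y (\1_(rect k0 (@setT (Z j)) : set X) y)%:E)%E.
  by rewrite integral_indic// setIT.
have mind j : measurable_fun setT (EFin \o (\1_(rect k0 (@setT (Z j)) : set X) : X -> R)).
  by apply/measurable_EFinP; exact: measurable_indic.
rewrite !ind -!ge0_integralZl_EFin ?sqr_ge0//; try exact: mind.
rewrite -ge0_integralD//; try by apply: measurable_funeM; exact: mind.
2,3: by move=> y _; rewrite mule_ge0// lee_fin ?sqr_ge0.
apply: ge0_le_integral => //.
- by move=> y _; rewrite adde_ge0// mule_ge0// lee_fin ?sqr_ge0.
- by apply: emeasurable_funD; apply: measurable_funeM; exact: mind.
- by apply: measurable_sqr; exact: measurable_subc.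
move=> y _; rewrite !indic_rect -!EFinM -EFinD lee_fin.
have [->|yk] := eqVneq (tag y) k; first by rewrite (negPf kl) mulr1 mulr0 addr0.
by have [->|yl] := eqVneq (tag y) l; rewrite mulr0 add0r ?mulr1// mulr0 sqr_ge0.
Qed.

Lemma block_jump k l :
  (exists2 c : R, 0 < c & forall z : Z k, (c%:E <= P (inj k0 z) (rect k0 (@setT (Z k))))%E) ->
  (0 < \int[Phi k]_z P (inj k0 z) (rect k0 (@setT (Z l))))%E ->
  exists2 b : R, 0 <= b & forall (f : X -> R) (m : K -> R), measurable_fun setT f ->
    (((m k - m l) ^+ 2)%:E <=
      b%:E * (\int[Pi]_x kvar P f x + sqint Pi (fun x => m (tag x) - f x)%R))%E.
Proof.
move=> [c c0 hc] q0.
have mP : measurable_fun setT (fun x => P x (rect k0 (@setT (Z l)))).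
  by apply: measurable_kernel; exact: measurable_rect.
have c1 : c <= 1.
  rewrite -lee_fin; apply: (le_trans (hc point)).
  by apply: pker_le1; exact: measurable_rect.
set q := (\int[Phi k]_z _)%E in q0.
have qfin : q \is a fin_num.
  rewrite ge0_fin_numE ?ltW//; apply: (@le_lt_trans _ _ (\int[Phi k]_z 1)%E).
    apply: ge0_le_integral => //; first exact: (measurable_comp_inj (k := k) mP).
    by move=> z _; apply: pker_le1; exact: measurable_rect.
  by rewrite integral_cst// mul1e probability_lty.
have q0' : 0 < fine q by rewrite fine_gt0// q0 ltey_eq qfin.
(* [p k] is the weight of block k in Pi, [q] the average probability of moving from k to l, and
   [c / 4] comes from [kernel_jump]. *)
exists ((p k)%:num * (c * fine q / 4))^-1.
  by rewrite invr_ge0 !mulr_ge0// ltW.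
move=> f m mf; apply: ereal_le_divl; first by rewrite !mulr_gt0// invr_gt0.
have mG : measurable_fun setT (fun x : X => m (tag x) - f x).
  by apply: measurable_funB => //; exact: measurable_block_cst.
have mH : measurable_fun setT
    (fun x => kvar P f x + sqint (P x) (fun y : X => m (tag y) - f y)%R)%E.
  by apply: emeasurable_funD; [exact: measurable_kvar|exact: measurable_sqint].
(* Invariance rewrites the error m - f under Pi as its average under the laws [P x], so that
   [kernel_jump] can be integrated. *)
have -> : (\int[Pi]_x kvar P f x + sqint Pi (fun x => m (tag x) - f x)%R =
    \int[Pi]_x (kvar P f x + sqint (P x) (fun y : X => m (tag y) - f y)%R))%E.
  rewrite [RHS]ge0_integralD//.
  - congr (_ + _)%E; apply/esym/(integral_kinvariant P_inv) => //.
      by move=> y; rewrite lee_fin sqr_ge0.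
    exact: measurable_sqr.
  - by move=> y _; exact: kvar_ge0.
  - exact: measurable_kvar.
  - by move=> y _; exact: sqint_ge0.
  - exact: measurable_sqint.
apply: le_trans (@integral_block_le k _ _ mH); last first.
  by move=> x; rewrite adde_ge0 ?kvar_ge0 ?sqint_ge0.
have n0 : 0 <= c * (m k - m l) ^+ 2 / 4.
  by apply: divr_ge0 => //; apply: mulr_ge0; [exact: ltW|exact: sqr_ge0].
rewrite EFinM -muleA; apply: lee_wpmul2l; first by rewrite lee_fin.
apply: (@le_trans _ _ (\int[Phi k]_z
    ((c * ((m k - m l) ^+ 2) / 4)%:E * P (inj k0 z) (rect k0 (@setT (Z l)))))%E).
  rewrite ge0_integralZl_EFin//; last exact: (measurable_comp_inj (k := k) mP).
  rewrite -/q -(fineK qfin) -!EFinM lee_fin le_eqVlt; apply/orP; left; apply/eqP.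
  by ring.
apply: ge0_le_integral => //.
- by move=> z _; rewrite mule_ge0.
- by apply: measurable_funeM; exact: (measurable_comp_inj (k := k) mP).
- exact: (measurable_comp_inj (k := k) mH).
by move=> z _; apply: kernel_jump => //; exact: ltW.
Qed.

End block_estimates.

(** Each side is the loss of squared norm, after one and after t steps; the t - 1 steps that follow
    the first are contractions. For t = 0 the right side vanishes. *)
Lemma integral_kvar_kiter d (Y : measurableType d) (R : realType)
    (om : probability Y R) (T : R.-pker Y ~> Y) t (f : Y -> R) :
  kinvariant om T -> (0 < t)%N -> measurable_fun setT f -> (sqint om f < +oo)%E ->
  (\int[om]_y kvar T f y <= \int[om]_y kvar (kiter T t) f y)%E.
Proof.
move=> inv t0 mf hf.
have e1 := sqint_kvar inv mf hf.
have e2 := sqint_kvar (kinvariant_kiter t inv) mf hf.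
have h1 := le_lt_trans (sqint_kop_le inv mf hf) hf.
have h2 : (sqint om (kop (kiter T t) f) <= sqint om (kop T f))%E.
  rewrite -sqint_kpow// -(prednK t0) /kpow iterSr.
  by apply: (sqint_kpow_le t.-1 inv) => //; exact: measurable_kop.
rewrite e1 in e2; move: e2 h2.
rewrite -(fineK (sqint_fin h1)) -(fineK (sqint_fin hf)) in e1 *.
move: e1.
move: (fine (sqint om f)) (fine (sqint om (kop T f))) (sqint om (kop (kiter T t) f))
  (\int[om]_y kvar T f y)%E (\int[om]_y kvar (kiter T t) f y)%E => a b c v w.
case: v => [v| |] // _; case: c => [c| |] //; case: w => [w| |] //.
by rewrite -!EFinD => -[e]; rewrite !lee_fin; lra.
Qed.

(** * Poincare inequality and spectral gap for the t-step chain *)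

Section poincare.
Context (R : realType) (K : finType) (k0 : K) (dZ : K -> measure_display)
  (Z : forall k, measurableType (dZ k)).
Local Notation X := (Xsp k0 Z).
Variables (p : K -> {nonneg R}) (Phi : forall k, probability (Z k) R)
  (Pi : probability X R).
Hypothesis p_gt0 : forall k, 0 < (p k)%:num.
Hypothesis Pi_rect : forall k (A : set (Z k)), measurable A ->
  Pi (rect k0 A) = ((p k)%:num%:E * Phi k A)%E.
Variables (P : R.-pker X ~> X) (t : nat).
Hypothesis P_inv : kinvariant Pi P.
Hypothesis t_gt0 : (0 < t)%N.
Hypothesis local_gap : forall k, exists Pk : R.-pker Z k ~> Z k,
     [/\ kinvariant (Phi k) Pk, (opnorm (Phi k) (kpow Pk t) < 1%:E)%E
       & exists c : R, 0 < c /\ forall z (A : set (Z k)), measurable A ->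
             (c%:E * Pk z A <= P (mixinj k0 z) (rect k0 A))%E].
Variables (G : 'M[int]_#|K|) (s : nat).
Hypothesis G_ge0 : forall i j, 0 <= G i j.
Hypothesis G_edge : forall i j, 0 < G i j ->
  (0 < \int[Phi (enum_val i)]_z
         P (inj k0 z) (rect k0 (@setT (Z (enum_val j)))))%E.
Hypothesis G_pow : forall i j, 0 < (G ^+ s) i j.

Local Notation blk f k := (f \o @inj K k0 dZ Z k).
Local Notation bmean f := (fun k => mean (Phi k) (blk f k)).

Lemma block_variances : exists2 a : R, 0 <= a & forall f : X -> R,
  measurable_fun setT f -> (sqint Pi f < +oo)%E ->
  (sqint Pi (fun x => bmean f (tag x) - f x)%R <=
     a%:E * \int[Pi]_x kvar (kiter P t) f x)%E.
Proof.
have /choice[a ha] : forall k, exists a : R, 0 <= a /\ forall f : X -> R,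
    measurable_fun setT f -> (sqint Pi f < +oo)%E ->
    ((p k)%:num%:E * sqint (Phi k) (fun z => blk f k z - bmean f k)%R
      <= a%:E * \int[Pi]_x kvar (kiter P t) f x)%E.
  by move=> k; have [a a0 h] := block_variance p_gt0 Pi_rect (local_gap k); exists a.
exists (\sum_k a k); first by apply: sumr_ge0 => k _; exact: (ha k).1.
move=> f mf hf; rewrite /sqint (integral_mix Pi_rect); last 2 first.
- by move=> x; rewrite lee_fin sqr_ge0.
- by apply: measurable_sqr; apply: measurable_funB => //; exact: (measurable_block_cst (bmean f)).
rewrite -sumEFin ge0_sume_distrl; last by move=> k _; rewrite lee_fin (ha k).1.
apply: lee_sum => k _; apply: le_trans ((ha k).2 f mf hf).
rewrite /sqint; under eq_integral do rewrite -sqrrN opprB.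
exact: lexx.
Qed.

Lemma block_jumps : exists2 b : R, 0 <= b & forall i j, 0 < G i j ->
  forall (f : X -> R) (m : K -> R), measurable_fun setT f ->
    (((m (enum_val i) - m (enum_val j)) ^+ 2)%:E <=
      b%:E * (\int[Pi]_x kvar P f x + sqint Pi (fun x => m (tag x) - f x)%R))%E.
Proof.
have /choice[b hb] : forall ij : 'I_#|K| * 'I_#|K|, exists b : R, 0 <= b /\
    (0 < G ij.1 ij.2 -> forall (f : X -> R) (m : K -> R), measurable_fun setT f ->
    (((m (enum_val ij.1) - m (enum_val ij.2)) ^+ 2)%:E <=
      b%:E * (\int[Pi]_x kvar P f x + sqint Pi (fun x => m (tag x) - f x)%R))%E).
  move=> [i j] /=; have [Gij|_] := boolP (0 < G i j); last by exists 0.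
  have [] := @block_jump R K k0 dZ Z p Phi Pi p_gt0 Pi_rect P P_inv (enum_val i) (enum_val j).
  - have [Pk [_ _ [c [c0 dom]]]] := local_gap (enum_val i).
    exists c => // z; have Pk1 : Pk z setT = 1%E by exact: prob_kernel.
    by rewrite -[c%:E]mule1 -Pk1; exact: dom.
  - exact: G_edge.
  by move=> b b0 hb; exists b.
exists (\sum_ij b ij); first by apply: sumr_ge0 => k _; exact: (hb k).1.
move=> i j Gij f m mf; apply: (le_trans ((hb (i, j)).2 Gij f m mf)).
apply: lee_wpmul2r.
  by rewrite adde_ge0 ?sqint_ge0//; apply: integral_ge0 => x _; exact: kvar_ge0.
by rewrite lee_fin; apply: sumr_ge_term => ij; exact: (hb ij).1.
Qed.

Lemma poincare : exists2 C : R, 0 <= C & forall f : X -> R, L2_0 Pi f ->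
  (sqint Pi f <= C%:E * \int[Pi]_x kvar (kiter P t) f x)%E.
Proof.
have [a a0 ha] := block_variances; have [b b0 hb] := block_jumps.
(* With v the integrated t-step variance, a jump along one edge is at most [b * (1 + a) * v]: 1 for
   the one-step variance, [a] for replacing f by its block means. Paths of length s give
   [4 ^+ s]. *)
pose M := 4 ^+ s * (b * (1 + a)).
exists (a + (\sum_k (p k)%:num) * M) => [|f [mf /L2norm_lty hf f0]].
  by rewrite addr_ge0// mulr_ge0 ?sumr_ge0// !mulr_ge0 ?exprn_ge0 ?addr_ge0.
have := ha f mf hf; have kle := integral_kvar_kiter P_inv t_gt0 mf hf.
have e := sqint_kvar (kinvariant_kiter t P_inv) mf hf.
have v0 : (0 <= \int[Pi]_x kvar (kiter P t) f x)%E.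
  by apply: integral_ge0 => x _; exact: kvar_ge0.
have vfin : (\int[Pi]_x kvar (kiter P t) f x)%E \is a fin_num.
  by rewrite ge0_fin_numE// (le_lt_trans _ hf)// e leeDr// sqint_ge0.
move: kle v0; rewrite -(fineK vfin); move: (fine _) => v {e vfin} kle.
rewrite lee_fin => v0 av.
pose m := bmean f.
have jump i j : 0 < G i j -> (m (enum_val i) - m (enum_val j)) ^+ 2 <= b * (1 + a) * v.
  move=> Gij; rewrite -lee_fin; apply: (le_trans (hb i j Gij f m mf)).
  rewrite -mulrA EFinM; apply: lee_wpmul2l; first by rewrite lee_fin.
  by rewrite mulrDl mul1r EFinD EFinM; exact: leeD.
have far k : (m k - m k0) ^+ 2 <= M * v.
  rewrite -(enum_rankK k) -(enum_rankK k0) /M -[leRHS]mulrA.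
  apply: (matrix_power_dist G_ge0 (m := fun i => m (enum_val i))) => //.
  by rewrite !mulr_ge0 ?addr_ge0.
have Pi1 : (Pi : {measure set X -> \bar R}) setT = 1%E := probability_setT Pi.
have mk k := measurable_comp_inj (k := k) mf.
have hk k : (sqint (Phi k) (blk f k) < +oo)%E := sqint_block_lty p_gt0 Pi_rect k mf hf.
have Phi1 k : (Phi k : {measure set (Z k) -> \bar R}) setT = 1%E := probability_setT (Phi k).
(* f has mean 0, which minimises the second moment: recentre at the constant m k0 *)
have -> : sqint Pi f = sqint Pi (fun x => f x - mean Pi f).
  by rewrite /mean f0; congr sqint; apply/funext => x; rewrite subr0.
apply: (le_trans (sqint_sub_mean_le (m k0) Pi1 mf)).
rewrite /sqint (integral_mix Pi_rect); last 2 first.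
- by move=> x; rewrite lee_fin sqr_ge0.
- exact/measurable_sqr/measurable_subc.
rewrite (eq_bigr (fun k => (p k)%:num%:E * sqint (Phi k) (fun z => blk f k z - m k)%R +
   ((p k)%:num * (m k - m k0) ^+ 2)%:E)%E); last first.
  move=> k _; have := sqint_sub_mean (m k0) (Phi1 k) (mk k) (hk k).
  rewrite {1}/sqint => ->.
  by rewrite ge0_muleDr ?sqint_ge0 ?lee_fin ?sqr_ge0// -EFinM.
rewrite big_split/= -EFinM mulrDl EFinD EFinM; apply: leeD.
  apply: le_trans av; rewrite /sqint (integral_mix Pi_rect); last 2 first.
  - by move=> x; rewrite lee_fin sqr_ge0.
  - by apply: measurable_sqr; apply: measurable_funB => //; exact: (measurable_block_cst (bmean f)).
  apply: lee_sum => k _; apply: lee_wpmul2l; first by rewrite lee_fin.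
  under [leRHS]eq_integral do rewrite -sqrrN opprB.
  exact: lexx.
rewrite sumEFin lee_fin -mulrA mulr_suml; apply: ler_sum => k _.
by rewrite ler_wpM2l.
Qed.

Lemma spectral_gap : exists2 r : R, 0 <= r < 1 & forall f : X -> R, L2_0 Pi f ->
  (sqint Pi (kpow P t f) <= r%:E * sqint Pi f)%E.
Proof.
have [C C0 hC] := poincare.
have C1 : 0 < C + 1 by rewrite ltr_wpDl.
(* Plays the role of 1 - 1/C while allowing C = 0. If the norms satisfy a = b + v and a <= C v, then
   b <= C v, so b (C + 1) <= C a. *)
exists (C / (C + 1)).
  by rewrite divr_ge0 ?(ltW C1)//= ltr_pdivrMr// mul1r ltrDl.
move=> f f0; have := hC f f0; have [mf /L2norm_lty hf _] := f0.
have hq := le_lt_trans (sqint_kpow_le t P_inv mf hf) hf.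
have := sqint_kvar (kinvariant_kiter t P_inv) mf hf.
have : (0 <= \int[Pi]_x kvar (kiter P t) f x)%E.
  by apply: integral_ge0 => x _; exact: kvar_ge0.
rewrite -sqint_kpow// -(fineK (sqint_fin hf)) -(fineK (sqint_fin hq)).
move: (fine (sqint Pi f)) (fine (sqint Pi (kpow P t f))) (\int[Pi]_x _)%E => a b v.
case: v => [v| |] //; rewrite -!EFinM -EFinD lee_fin => v0 -[->]; rewrite !lee_fin => h.
rewrite mulrAC ler_pdivlMr//.
have : b <= C * v by rewrite (le_trans _ h)// lerDl.
by rewrite mulrDr mulrDr mulr1 [b * C]mulrC lerD2l.
Qed.

End poincare.

(** * Densities and geometric convergence *)

Section density.
Context d (Y : measurableType d) (R : realType).
Implicit Types (nu om : probability Y R) (g f : Y -> R).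

(** [is_density] speaks of sets only; the duality needs a version that is nonnegative everywhere and
    changes variables for functions. *)
Lemma density_exists nu om : nu `<< om -> exists g,
  [/\ measurable_fun setT g, (forall y, 0 <= g y) &
    forall h : Y -> \bar R, (forall y, 0 <= h y)%E -> measurable_fun setT h ->
      (\int[nu]_y h y = \int[om]_y (h y * (g y)%:E))%E].
Proof.
move=> dom; pose g := Radon_Nikodym_SigmaFinite.f nu om.
have gfin := Radon_Nikodym_SigmaFinite.f_fin_num dom.
have mg : measurable_fun setT g.
  exact: measurable_int (Radon_Nikodym_SigmaFinite.f_integrable dom).
exists (fine \o g); split.
- exact: (measurableT_comp (fine_measurable measurableT) mg).
- by move=> y; rewrite fine_ge0// (Radon_Nikodym_SigmaFinite.f_ge0 dom).
move=> h h0 mh; rewrite -(Radon_Nikodym_SigmaFinite.change_of_variables dom h0)//.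
by apply: eq_integral => y _; rewrite /= fineK//; exact: gfin.
Qed.

Section change_of_measure.
Variables (nu om : probability Y R) (g : Y -> R).
Hypothesis mg : measurable_fun setT g.
Hypothesis g0 : forall y, 0 <= g y.
Hypothesis dens : forall h : Y -> \bar R, (forall y, 0 <= h y)%E ->
  measurable_fun setT h -> (\int[nu]_y h y = \int[om]_y (h y * (g y)%:E))%E.

Lemma density_is_density : is_density om nu g.
Proof.
split=> // B mB; rewrite -[in LHS](setIT B) -integral_indic// dens; last 2 first.
- by move=> y; rewrite lee_fin.
- by apply/measurable_EFinP; exact: measurable_indic.
rewrite [RHS]integral_mkcond; apply: eq_integral => y _.
rewrite patchE indicE; case: (y \in B); first by rewrite mul1e.
by rewrite mul0e.
Qed.

Lemma integrable_density f : nu.-integrable setT (EFin \o f) ->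
  om.-integrable setT (fun y => (f y * g y)%:E).
Proof.
move=> /integrableP[mf fi]; apply/integrableP; split.
  by apply/measurable_EFinP; apply: measurable_funM => //; exact/measurable_EFinP.
rewrite dens// in fi; last exact: measurableT_comp.
apply: le_lt_trans fi; rewrite le_eqVlt; apply/orP; left; apply/eqP.
by apply: eq_integral => y _; rewrite EFinM abseM (@gee0_abs _ (g y)%:E) ?lee_fin.
Qed.

Lemma integral_density f : nu.-integrable setT (EFin \o f) ->
  (\int[nu]_y (f y)%:E = \int[om]_y (f y * g y)%:E)%E.
Proof.
move=> fi; have mf := measurable_int _ fi.
have ip := integrable_density (integrable_funrpos measurableT fi).
have im := integrable_density (integrable_funrneg measurableT fi).
rewrite [LHS](integralE _ _ (EFin \o f)) funerpos funerneg !dens//; last 4 first.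
- by move=> y; rewrite lee_fin.
- exact: measurable_int (integrable_funrneg measurableT fi).
- by move=> y; rewrite lee_fin.
- exact: measurable_int (integrable_funrpos measurableT fi).
rewrite -integralB//; apply: eq_integral => y _ /=.
rewrite -!EFinM -EFinB -mulrBl; congr ((_ * _)%:E).
by rewrite -[RHS]/(f y) -{3}(funrposBneg f).
Qed.

End change_of_measure.

Lemma density_dominates nu om g : is_density om nu g -> nu `<< om.
Proof.
move=> [mg gB]; apply/null_content_dominatesP => B mB B0.
by rewrite gB// null_set_integral//; apply/measurable_EFinP; exact: measurable_funTS.
Qed.

Lemma is_density_unique nu om f g : om.-integrable setT (EFin \o f) ->
  is_density om nu f -> is_density om nu g ->
  ae_eq om setT (EFin \o f) (EFin \o g).
Proof.
move=> fi [mf fB] [mg gB]; apply: integral_ae_eq => //; first exact/measurable_EFinP.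
by move=> B _ mB; rewrite -fB// -gB.
Qed.

End density.

(** * Geometric decay from one contracting power *)

Section decay.
Context d (Y : measurableType d) (R : realType).
Variables (om : probability Y R) (T : R.-pker Y ~> Y).
Hypothesis inv : kinvariant om T.

Lemma L2_0_kop f : L2_0 om f -> L2_0 om (kop T f).
Proof.
move=> [mf /L2norm_lty hf f0]; split.
- exact: measurable_kop.
- by apply/L2norm_lty; exact: le_lt_trans (sqint_kop_le inv mf hf) hf.
- by rewrite integral_kop//; exact: (integrable_of_sqr (probability_setT om) mf hf).
Qed.

Lemma L2_0_kpow n f : L2_0 om f -> L2_0 om (kpow T n f).
Proof. by move=> f0; elim: n => // n; exact: L2_0_kop. Qed.

Variables (t : nat) (r : R).
Hypotheses (t0 : (0 < t)%N) (r0 : 0 <= r) (r1 : r < 1).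
Hypothesis gap : forall f, L2_0 om f ->
  (sqint om (kpow T t f) <= r%:E * sqint om f)%E.

Lemma kpow_gapX q f : L2_0 om f ->
  (sqint om (kpow T (q * t) f) <= (r ^+ q)%:E * sqint om f)%E.
Proof.
move=> f0; elim: q => [|q ih]; first by rewrite mul0n expr0 mul1e.
rewrite mulSn /kpow iterD -/(kpow T t _) -/(kpow T (q * t) f).
apply: (le_trans (gap (L2_0_kpow _ f0))); rewrite exprS EFinM -muleA.
by apply: lee_wpmul2l => //; rewrite lee_fin.
Qed.

Lemma bernoulli_le (x : R) n : 0 <= x -> x <= 1 -> 1 - n%:R * x <= (1 - x) ^+ n.
Proof.
move=> x0 x1; elim: n => [|n ih]; first by rewrite expr0 mul0r subr0.
rewrite exprS; apply: (@le_trans _ _ ((1 - x) * (1 - n%:R * x))); last first.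
  by rewrite ler_wpM2l// subr_ge0.
rewrite -natr1; have : 0 <= n%:R * x * x by rewrite !mulr_ge0.
by move: (n%:R) => m; nra.
Qed.

Lemma kpow_decay : exists rho C : R, [/\ 0 < rho, rho < 1, 0 < C &
  forall n f, L2_0 om f ->
    (sqint om (kpow T n f) <= ((C * rho ^+ n) ^+ 2)%:E * sqint om f)%E].
Proof.
(* By Bernoulli's inequality this rho satisfies r <= rho^(2t). *)
pose x := (1 - r) / (2 * t)%:R; pose rho := 1 - x.
have t2 : 1 < (2 * t)%:R :> R by rewrite ltr1n; lia.
have t20 : 0 < (2 * t)%:R :> R by apply: lt_trans t2.
have x0 : 0 < x by rewrite divr_gt0// subr_gt0.
have x1 : x < 1 by rewrite ltr_pdivrMr// mul1r (le_lt_trans _ t2)// gerBl.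
have rho0 : 0 < rho by rewrite subr_gt0.
have rho1 : rho < 1 by rewrite ltrBlDr ltrDl.
have rrho : r <= rho ^+ (2 * t).
  apply: le_trans (bernoulli_le (2 * t) (ltW x0) (ltW x1)).
  by rewrite mulrC /x divfK ?gt_eqF// subKr.
(* The [n %% t] leftover steps are merely contractions; the missing decay is at most t factors of
   [rho], which C restores. This needs [rho] positive even when r = 0. *)
exists rho, (rho ^+ t)^-1; split => //; first by rewrite invr_gt0 exprn_gt0.
move=> n f f0; have [mf /L2norm_lty hf _] := f0.
rewrite {1}(divn_eq n t) addnC /kpow iterD -/(kpow T (n %/ t * t) f) -/(kpow T (n %% t) _).
have [mg /L2norm_lty hg _] := L2_0_kpow (n %/ t * t) f0.
apply: (le_trans (sqint_kpow_le _ inv mg hg)).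
apply: (le_trans (kpow_gapX _ f0)); apply: lee_wpmul2r; first exact: sqint_ge0.
rewrite lee_fin; apply: (@le_trans _ _ ((rho ^+ (2 * t)) ^+ (n %/ t))).
  by rewrite lerXn2r// nnegrE exprn_ge0// ltW.
rewrite exprMn exprVn mulrC ler_pdivlMr ?exprn_gt0// -!exprM -exprD.
rewrite ler_wiXn2l ?(ltW rho0) ?(ltW rho1)//.
by have := ltn_ceil n t0; lia.
Qed.

End decay.

Section transported_law.
Context d (Y : measurableType d) (R : realType).
Variables (mu : probability Y R) (Q : R.-pker Y ~> Y).

(** The law [mu Q], read off a composite kernel so that it inherits the structure of a measure. *)
Definition transport : set Y -> \bar R :=
  kthen (kcst mu : R.-pker Y ~> Y) Q point.

HB.instance Definition _ := Measure.on transport.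

Let transport_setT : transport setT = 1%E.
Proof. exact: prob_kernel. Qed.

HB.instance Definition _ :=
  Measure_isProbability.Build _ _ _ transport transport_setT.

Lemma transportE A : transport A = (\int[mu]_y Q y A)%E.
Proof. by []. Qed.

(** By invariance an [om]-null set has [Q y]-measure 0 for [om]-almost every y, hence for
    [mu]-almost every y. *)
Lemma transport_dominates (om : probability Y R) :
  kinvariant om Q -> mu `<< om -> transport `<< om.
Proof.
move=> inv dom; apply/null_content_dominatesP => B mB B0.
have mQ : measurable_fun setT (fun y => Q y B) by exact: measurable_kernel.
have Q0 : ae_eq om setT (fun y => Q y B) (cst 0%E).
  apply/(ae_eq_integral_abs om measurableT mQ).
  by under eq_integral do rewrite gee0_abs//; rewrite inv.
rewrite transportE (ae_eq_integral (cst 0%E))// ?integral0//.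
exact: null_dominates_ae_eq dom Q0.
Qed.

End transported_law.

(** Indicators are integrable under every n-step law, so [kpow] and [kiter] agree on them at every
    point. *)
Lemma mker_transport d (Y : measurableType d) (R : realType)
    (mu : probability Y R) (T : R.-pker Y ~> Y) n B : measurable B ->
  mker mu T n B = transport mu (kiter T n) B.
Proof.
move=> mB; rewrite transportE; apply: eq_integral => y _.
have i : (kiter T n y).-integrable setT (EFin \o \1_B).
  apply/integrableP; split; first exact/measurable_EFinP/measurable_indic.
  under eq_integral do rewrite gee0_abs ?lee_fin//.
  by rewrite integral_indic// setIT (le_lt_trans (pker_le1 _ _ mB))// ltry.
rewrite kpow_kiter// /kop integral_indic// setIT fineK//.
by rewrite ge0_fin_numE// (le_lt_trans (pker_le1 _ _ mB))// ltry.
Qed.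

(** * Contraction of densities by duality *)

Section density_contraction.
Context d (Y : measurableType d) (R : realType).

Lemma bounded_integrable (mu : {measure set Y -> \bar R}) (f : Y -> R) (M : R) :
  mu setT = 1%E -> measurable_fun setT f -> (forall y, `|f y| <= M) ->
  mu.-integrable setT (EFin \o f).
Proof.
move=> mu1 mf fM; have : mu.-integrable setT (fun=> M%:E).
  by apply: integrable_cst; rewrite mu1 ltry.
apply: le_integrable => //; first exact/measurable_EFinP.
by move=> y _ /=; rewrite lee_fin (le_trans (fM y))// ler_norm.
Qed.

Lemma kop_bounded (Q : R.-pker Y ~> Y) (f : Y -> R) (M : R) y :
  measurable_fun setT f -> (forall y, `|f y| <= M) -> `|kop Q f y| <= M.
Proof.
move=> mf fM; have Q1 : Q y setT = 1%E by exact: prob_kernel.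
have fi := bounded_integrable Q1 mf fM.
rewrite -lee_fin /kop -abse_EFin fineK ?integrable_fin_num//.
apply: (le_trans (le_abse_integral _ measurableT (measurable_int _ fi))).
apply: (@le_trans _ _ (\int[Q y]_z M%:E)%E); last by rewrite integral_cst// Q1 mule1.
apply: ge0_le_integral => //; last by move=> z _; rewrite lee_fin.
by apply: measurableT_comp => //; exact: measurable_int fi.
Qed.

Variables (om mu : probability Y R) (Q : R.-pker Y ~> Y) (gm g : Y -> R).
Hypothesis inv : kinvariant om Q.
Hypothesis mgm : measurable_fun setT gm.
Hypothesis gm0 : forall y, 0 <= gm y.
Hypothesis gm_dens : forall h : Y -> \bar R, (forall y, 0 <= h y)%E ->
  measurable_fun setT h -> (\int[mu]_y h y = \int[om]_y (h y * (gm y)%:E))%E.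
Hypothesis mg : measurable_fun setT g.
Hypothesis g0 : forall y, 0 <= g y.
Hypothesis g_dens : forall h : Y -> \bar R, (forall y, 0 <= h y)%E ->
  measurable_fun setT h ->
  (\int[transport mu Q]_y h y = \int[om]_y (h y * (g y)%:E))%E.

Let om1 : (om : {measure set Y -> \bar R}) setT = 1%E := probability_setT om.
Let mu1 : (mu : {measure set Y -> \bar R}) setT = 1%E := probability_setT mu.
Let nu1 : (transport mu Q : {measure set Y -> \bar R}) setT = 1%E :=
  probability_setT (transport mu Q).

Lemma integrable_density_sub1 (nu : probability Y R) (f k : Y -> R) (M : R) :
  measurable_fun setT k -> (forall y, 0 <= k y) ->
  (forall h : Y -> \bar R, (forall y, 0 <= h y)%E -> measurable_fun setT h ->
    (\int[nu]_y h y = \int[om]_y (h y * (k y)%:E))%E) ->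
  measurable_fun setT f -> (forall y, `|f y| <= M) ->
  om.-integrable setT (fun y => (f y * (k y - 1))%:E) /\
  (\int[om]_y (f y * (k y - 1))%:E = \int[nu]_y (f y)%:E - \int[om]_y (f y)%:E)%E.
Proof.
move=> mk k0 kd mf fM.
have nuT : (nu : {measure set Y -> \bar R}) setT = 1%E := probability_setT nu.
have i1 := integrable_density mk k0 kd (bounded_integrable nuT mf fM).
have i2 := bounded_integrable om1 mf fM.
have e y : (f y * (k y - 1))%:E = ((f y * k y)%:E - (f y)%:E)%E.
  by rewrite -EFinB mulrBr mulr1.
under eq_fun do rewrite e; split; first exact: integrableB.
by rewrite integralB_EFin// (integral_density mk k0 kd (bounded_integrable nuT mf fM)).
Qed.

(** Both sides are the integral of f under [mu Q] minus that under [om], the latter being unchanged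
    by Q. Boundedness of f makes all terms finite without square integrability of g. *)
Lemma density_duality (f : Y -> R) (M : R) : measurable_fun setT f ->
  (forall y, `|f y| <= M) ->
  (\int[om]_y (f y * (g y - 1))%:E = \int[om]_y (kop Q f y * (gm y - 1))%:E)%E.
Proof.
move=> mf fM.
have [_ ->] := integrable_density_sub1 mg g0 g_dens mf fM.
have [_ ->] := integrable_density_sub1 mgm gm0 gm_dens (measurable_kop Q mf)
  (fun y => kop_bounded Q y mf fM).
congr (_ - _)%E; last first.
  by rewrite integral_kop//; exact: bounded_integrable om1 mf fM.
by rewrite (integral_mean_kthen (bounded_integrable nu1 mf fM)).
Qed.

Variable kappa : R.
Hypothesis kappa0 : 0 < kappa.
Hypothesis contr : forall f, L2_0 om f ->
  (sqint om (kop Q f) <= (kappa ^+ 2)%:E * sqint om f)%E.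
Hypothesis gm_fin : (sqint om (fun y => gm y - 1)%R < +oo)%E.

(* The identity [f * (g - 1) = f ^+ 2] holds when f is a truncation of g - 1.
   Truncating is needed because g is not known to be square integrable. *)
Lemma truncated_density_le (f : Y -> R) (M : R) : measurable_fun setT f ->
  (forall y, `|f y| <= M) -> (forall y, f y * (g y - 1) = f y ^+ 2) ->
  (sqint om f <= (kappa ^+ 2)%:E * sqint om (fun y => gm y - 1)%R)%E.
Proof.
move=> mf fM fg.
have fi := bounded_integrable om1 mf fM.
have hf : (sqint om f < +oo)%E.
  have : om.-integrable setT (EFin \o (fun y => f y ^+ 2)).
    apply: (bounded_integrable (M := M ^+ 2) om1); first exact: measurable_funX.
    by move=> y; rewrite normrX lerXn2r// nnegrE// (le_trans _ (fM y)).
  by move=> /integrable_lty; exact.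
pose m := mean om f; pose u y := f y - m.
have mu' : measurable_fun setT u by exact: measurable_subc.
have uM y : `|u y| <= M + `|m|.
  by rewrite (le_trans (ler_normB _ _))// lerD2r.
have u0 : L2_0 om u by exact: L2_0_center.
have hu : (sqint om u <= sqint om f)%E.
  have := sqint_sub_mean_le 0 om1 mf; rewrite (_ : (fun x => f x - 0) = f)//.
  by apply/funext => y; rewrite subr0.
have [iu _] := integrable_density_sub1 mg g0 g_dens mu' uM.
have [i1 e1] := integrable_density_sub1 mg g0 g_dens (measurable_cst m)
  (fun=> lexx `|m|).
have [i2 e2] := integrable_density_sub1 mg g0 g_dens mf fM.
(* [contr] needs mean 0; centring f does not change its pairing with g - 1, which integrates to
   0. *)
have e : sqint om f = (\int[om]_y (u y * (g y - 1))%:E)%E.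
  have -> : (\int[om]_y (u y * (g y - 1))%:E =
      \int[om]_y ((f y * (g y - 1))%:E - (m * (g y - 1))%:E))%E.
    by apply: eq_integral => y _; rewrite -EFinB mulrBl.
  rewrite integralB// e1 /= !integral_cst// [X in (_ * X)%E]nu1 mule1 [X in (_ * X)%E]om1 mule1.
  rewrite subee// sube0; apply: eq_integral => y _; by rewrite fg.
have ma := measurable_subc 1 mgm.
have mb := measurable_kop Q mu'.
have hb : (sqint om (kop Q u) <= (kappa ^+ 2)%:E * sqint om f)%E.
  apply: (le_trans (contr u0)); apply: lee_wpmul2l => //.
  by rewrite lee_fin sqr_ge0.
have hb' : (sqint om (kop Q u) < +oo)%E.
  by rewrite (le_lt_trans hb)// lte_mul_pinfty// lee_fin sqr_ge0.
have k2 : 0 < kappa ^+ 2 by rewrite exprn_gt0.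
(* The weights are chosen so that, by [hb], the second term is at most half of the finite left side
   and can be absorbed. *)
have up : (sqint om f <= (kappa ^+ 2 / 2)%:E * sqint om (fun y => gm y - 1)%R
    + ((kappa ^+ 2)^-1 / 2)%:E * sqint om (kop Q u))%E.
  rewrite e (density_duality mu' uM) /sqint -!ge0_integralZl_EFin; last first.
  all: try by [].
  all: try by rewrite divr_ge0// ?invr_ge0 ltW.
  all: try by move=> y _; rewrite lee_fin sqr_ge0.
  all: try exact: measurable_sqr.
  rewrite -integralD//; last 2 first.
  - by apply: integrableZl => //; exact: integrable_sqr.
  - by apply: integrableZl => //; exact: integrable_sqr.
  apply: le_integral => //.
  - exact: integrable_prod.
  - by apply: integrableD => //; apply: integrableZl => //; exact: integrable_sqr.
  move=> y _; rewrite -!EFinM -EFinD lee_fin.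
  (* AM-GM with weight kappa^2 *)
  rewrite -subr_ge0.
  have -> : kappa ^+ 2 / 2 * (gm y - 1) ^+ 2 + (kappa ^+ 2)^-1 / 2 * kop Q u y ^+ 2
    - kop Q u y * (gm y - 1) = (kappa * (gm y - 1) - kappa^-1 * kop Q u y) ^+ 2 / 2.
    by field; rewrite gt_eqF.
  by rewrite divr_ge0 ?sqr_ge0.
move: up hb; rewrite -(fineK (sqint_fin hf)) -(fineK (sqint_fin hb')).
rewrite -(fineK (sqint_fin gm_fin)) -!EFinM -EFinD !lee_fin.
move: (fine (sqint om f)) (fine (sqint om (kop Q u)))
  (fine (sqint om (fun y => gm y - 1))) (kappa ^+ 2) k2 => a b c k k2 up hb.
have : k^-1 / 2 * b <= a / 2 by rewrite mulrAC ler_wpM2r// ler_pdivrMl.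
by lra.
Qed.

(** Setting g - 1 to 0 where it exceeds n, rather than clipping it to n, keeps f (g - 1) = f^2. The
    squares increase to (g - 1)^2, and the bound is uniform in n, so monotone convergence gives both
    finiteness and the estimate. *)
Lemma density_contraction :
  (sqint om (fun y => g y - 1)%R <=
    (kappa ^+ 2)%:E * sqint om (fun y => gm y - 1)%R)%E.
Proof.
pose E n := [set y | `|g y - 1| <= n%:R].
have mE n : measurable (E n).
  rewrite -[E n]setTI; apply: measurable_fun_le => //.
  by apply: measurableT_comp => //; exact: measurable_subc.
pose f n y := (g y - 1) * \1_(E n) y.
have mf n : measurable_fun setT (f n).
  by apply: measurable_funM; [exact: measurable_subc|exact: measurable_indic].
have fE n y : f n y = if `|g y - 1| <= n%:R then g y - 1 else 0.
  rewrite /f indicE; case: ifPn => h; first by rewrite mem_set ?mulr1.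
  by rewrite memNset ?mulr0//; apply/negP.
have bound n : (sqint om (f n) <= (kappa ^+ 2)%:E * sqint om (fun y => gm y - 1)%R)%E.
  apply: (@truncated_density_le _ n%:R) => // y; rewrite fE.
    by case: ifP => // _; rewrite normr0.
  by case: ifP => // _; rewrite ?mul0r ?expr0n// -expr2.
have mono y : {homo (fun n => ((f n y) ^+ 2)%:E) : n m / (n <= m)%N >-> (n <= m)%E}.
  move=> n k nk; rewrite lee_fin !fE; case: ifPn => h1; last by rewrite expr0n sqr_ge0.
  by rewrite ifT// (le_trans h1)// ler_nat.
have cv : (sqint om (f n) @[n --> \oo] -->
    \int[om]_y limn (fun n => ((f n y) ^+ 2)%:E))%E.
  apply: cvg_monotone_convergence => //.
  - by move=> n; exact: measurable_sqr.
  - by move=> n y _; rewrite lee_fin sqr_ge0.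
have -> : sqint om (fun y => g y - 1) =
    (\int[om]_y limn (fun n => ((f n y) ^+ 2)%:E))%E.
  apply: eq_integral => y _; apply/esym/cvg_lim => //.
  apply: cvg_near_cst; exists (Num.bound `|g y - 1|) => // n /= hn.
  rewrite fE ifT// ltW// (lt_le_trans (archi_boundP _))// ler_nat//.
rewrite -(cvg_lim _ cv)//; apply: lime_le; first by apply/cvg_ex; eexists; exact: cv.
exact: nearW.
Qed.

End density_contraction.

Lemma decay_L2_geom_conv d (Y : measurableType d) (R : realType)
    (om : probability Y R) (T : R.-pker Y ~> Y) (rho C : R) :
  kinvariant om T -> 0 < rho -> rho < 1 -> 0 < C ->
  (forall n f, L2_0 om f ->
    (sqint om (kpow T n f) <= ((C * rho ^+ n) ^+ 2)%:E * sqint om f)%E) ->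
  L2_geom_conv om T.
Proof.
move=> inv rho0 rho1 C0 decay; exists rho; split => //.
have /choice[c hc] : forall mu : probability Y R, exists c : R, 0 <= c /\
    (L2star om mu -> forall n, exists g : Y -> R, is_density om (mker mu T n) g /\
      (L2norm om (fun y => (g y - 1)%R) <= (c * rho ^+ n)%:E)%E).
  (* C must be defined on all probabilities; outside [L2star] it is 0. *)
  move=> mu; have [mu2|] := pselect (L2star om mu); last by exists 0.
  have [h [mh /L2norm_lty hh hd]] := mu2.
  have dom := density_dominates hd.
  (* The given density h may be negative on a null set; [gm] is nonnegative everywhere, equals h
     almost everywhere and so inherits its square integrability. *)
  have [gm [mgm gm0 gm_dens]] := density_exists dom.
  have om1 : (om : {measure set Y -> \bar R}) setT = 1%E := probability_setT om.
  have gmd := density_is_density mgm gm_dens.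
  have hgm := is_density_unique (integrable_of_sqr om1 mh hh) hd gmd.
  have gm2 : (sqint om gm < +oo)%E.
    have <- : sqint om h = sqint om gm; last by [].
    apply: ge0_ae_eq_integral => //.
    - exact: measurable_sqr.
    - exact: measurable_sqr.
    - by move=> y _; rewrite lee_fin sqr_ge0.
    - by move=> y _; rewrite lee_fin sqr_ge0.
    by apply: filterS hgm => y /(_ I) [->].
  have w2 := sqint_sub_lty 1 (probability_lty om) mgm gm2.
  exists (C * Num.sqrt (fine (sqint om (fun y => gm y - 1)))).
  split=> [|_ n]; first by rewrite mulr_ge0 ?sqrtr_ge0// ltW.
  have invn := kinvariant_kiter n inv.
  have [g [mg g0 g_dens]] := density_exists (transport_dominates invn dom).
  have k0 : 0 < C * rho ^+ n by rewrite mulr_gt0// exprn_gt0.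
  exists g; split.
    have [_ gB] := density_is_density mg g_dens.
    by split => // B mB; rewrite mker_transport// gB.
  have con : (sqint om (fun y => g y - 1)%R <=
      ((C * rho ^+ n) ^+ 2)%:E * sqint om (fun y => gm y - 1)%R)%E.
    apply: (density_contraction invn mgm gm0 gm_dens mg g0 g_dens k0) => //.
    move=> f f0; have [mf /L2norm_lty hf _] := f0.
    by rewrite -sqint_kpow//; exact: decay.
  have fin : (sqint om (fun y => g y - 1)%R < +oo)%E.
    by rewrite (le_lt_trans con)// lte_mul_pinfty// lee_fin sqr_ge0.
  rewrite L2norm_fin// lee_fin mulrAC.
  rewrite -[X in X * _](ger0_norm (ltW k0)) -sqrtr_sqr -sqrtrM ?sqr_ge0//.
  rewrite ler_wsqrtr// -lee_fin EFinM !fineK//; exact: sqint_fin.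
exists c; split=> [mu _|mu]; [exact: (hc mu).1|exact: (hc mu).2].
Qed.

(** * Block weights and normalised block measures *)

Section mixture_weights.
Context (R : realType) (K : finType) (k0 : K) (dZ : K -> measure_display)
  (Z : forall k, measurableType (dZ k)).
Variables (Psi : forall k, {finite_measure set (Z k) -> \bar R}).
Hypothesis Psi_nz : forall k, Psi k setT != 0%E.

Definition mass k : R := fine (Psi k setT).

Lemma massE k : Psi k setT = (mass k)%:E.
Proof. by rewrite fineK// fin_num_measure. Qed.

Lemma mass_gt0 k : 0 < mass k.
Proof. by rewrite -lte_fin -massE lt0e Psi_nz measure_ge0. Qed.

Lemma mass_sum_gt0 : 0 < \sum_k mass k.
Proof.
apply: lt_le_trans (mass_gt0 k0) _; apply: sumr_ge_term => k.
exact: ltW (mass_gt0 k).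
Qed.

Lemma weight_ge0 k : 0 <= mass k / \sum_l mass l.
Proof. by rewrite divr_ge0// ltW ?mass_gt0 ?mass_sum_gt0. Qed.

Definition weight k : {nonneg R} := NngNum (weight_ge0 k).

Lemma weight_gt0 k : 0 < (weight k)%:num.
Proof. by rewrite divr_gt0 ?mass_gt0 ?mass_sum_gt0. Qed.

Variable Phi : forall k, probability (Z k) R.
Hypothesis Phi_def : forall k (A : set (Z k)), measurable A ->
  Phi k A = (Psi k A / Psi k setT)%E.

Lemma PhiE k A : measurable A -> Phi k A = ((mass k)^-1%:E * Psi k A)%E.
Proof.
by move=> mA; rewrite Phi_def// massE inver gt_eqF ?mass_gt0// muleC.
Qed.

Lemma weight_Phi k A : measurable A ->
  (Psi k A / (\sum_(k' : K) Psi k' setT) = (weight k)%:num%:E * Phi k A)%E.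
Proof.
move=> mA; rewrite PhiE//; under eq_bigr do rewrite massE.
rewrite sumEFin inver gt_eqF ?mass_sum_gt0// muleA -EFinM muleC.
by congr (_%:E * _)%E => /=; rewrite mulrAC divff ?mul1r// gt_eqF ?mass_gt0.
Qed.

Lemma integral_Phi k (h : Z k -> \bar R) : (forall z, 0 <= h z)%E ->
  measurable_fun setT h ->
  (\int[Phi k]_z h z = (mass k)^-1%:E * \int[Psi k]_z h z)%E.
Proof.
move=> h0 mh; have m0 : 0 <= (mass k)^-1 by rewrite invr_ge0 ltW ?mass_gt0.
rewrite (eq_measure_integral (mscale (NngNum m0) (Psi k))); last first.
  by move=> A mA _; exact: PhiE.
by rewrite ge0_integral_mscale.
Qed.

End mixture_weights.

Section GammaP_entries.
Context (R : realType) (K : finType) (k0 : K) (dZ : K -> measure_display)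
  (Z : forall k, measurableType (dZ k)).
Variables (Psi : forall k, {finite_measure set (Z k) -> \bar R})
  (P : R.-pker (Xsp k0 Z) ~> (Xsp k0 Z)).

Lemma GammaP_ge0 i j : 0 <= GammaP Psi P i j.
Proof. by rewrite mxE; case: ifP. Qed.

Lemma GammaP_gt0 i j : 0 < GammaP Psi P i j ->
  (0 < \int[Psi (enum_val i)]_z
         P (inj k0 z) (rect k0 (@setT (Z (enum_val j)))))%E.
Proof. by rewrite mxE; case: ifP. Qed.

End GammaP_entries.

Unset Implicit Arguments. Set Strict Implicit.

Theorem theorem1 (R : realType) (K : finType) (k0 : K)
  (dZ : K -> measure_display) (Z : forall k, measurableType (dZ k))
  (Psi : forall k, {finite_measure set (Z k) -> \bar R})
  (Psi_nz : forall k, Psi k setT != 0%E)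
  (Phi : forall k, probability (Z k) R)
  (Phi_def : forall k (A : set (Z k)), measurable A ->
     Phi k A = (Psi k A / Psi k setT)%E)
  (Pi : probability (Xsp k0 Z) R)
  (Pi_def : forall k (A : set (Z k)), measurable A ->
     Pi (rect k0 A) = (Psi k A / (\sum_(k' : K) Psi k' setT)%E)%E)
  (P : R.-pker (Xsp k0 Z) ~> (Xsp k0 Z))
  (P_inv : kinvariant Pi P)
  (t : nat) (t_pos : (0 < t)%N)
  (H1 : forall k : K, exists Pk : R.-pker (Z k) ~> (Z k),
     [/\ kinvariant (Phi k) Pk,
         (opnorm (Phi k) (kpow Pk t) < 1%:E)%E
       & exists c : R, 0 < c /\
           forall (z : Z k) (A : set (Z k)), measurable A ->
             (c%:E * Pk z A <= P (mixinj k0 z) (rect k0 A))%E])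
  (H2 : exists s : nat, (0 < s)%N /\
     forall i j, 0 < (GammaP Psi P ^+ s) i j) :
  (opnorm Pi (kpow P t) < 1%:E)%E /\ L2_geom_conv Pi P.
Proof.
have w0 := weight_gt0 k0 Psi_nz.
have Pi_rect k (A : set (Z k)) : measurable A ->
    Pi (rect k0 A) = ((weight k0 Psi_nz k)%:num%:E * Phi k A)%E.
  by move=> mA; rewrite Pi_def// (weight_Phi k0 Psi_nz Phi_def).
have [s [_ G_pow]] := H2.
have edge i j : 0 < GammaP Psi P i j ->
    (0 < \int[Phi (enum_val i)]_z
      P (inj k0 z) (rect k0 (@setT (Z (enum_val j)))))%E.
  (* [GammaP] integrates against [Psi]; dividing by a positive mass preserves positivity. *)
  move=> /GammaP_gt0 h; rewrite (integral_Phi Psi_nz Phi_def)//.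
    by rewrite mule_gt0// lte_fin invr_gt0 mass_gt0.
  apply: (measurable_comp_inj (k := enum_val i)
    (h := fun x => P x (rect k0 (@setT (Z (enum_val j)))))).
  by apply: measurable_kernel; exact: measurable_rect.
have [r /andP[r0 r1] gap] := spectral_gap w0 Pi_rect P_inv t_pos H1
  (GammaP_ge0 Psi P) edge G_pow.
split.
  apply/(opnorm_lt1P (sqint_kpow_le_L2_0 t P_inv)).
  by exists r; split.
have [rho [C [rho0 rho1 C0 decay]]] := kpow_decay P_inv t_pos r0 r1 gap.
exact: decay_L2_geom_conv P_inv rho0 rho1 C0 decay.
Qed.
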